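(* Suppose Assumptions (A1) and (A2) hold and that $E\,\mathcal{W}_1(\mu_0^N,\mu_0)\to 0$ as $N\to\infty$. Then for every $n\ge 0$, $$\lim_{N\to\infty} E\,\mathcal{W}_1(\mu_n^N,\mu_n)=0 .$$
   Context: Setting. Fix integers $d,m\ge1$, a real $d\times d$ matrix $A$ with operator norm $\|A\|=\sup_{x\neq 0}|Ax|/|x|$, a parameter $\delta>0$, a Borel probability measure $\theta$ on $\mathbb{R}^m$, and a measurable map $f:\mathbb{R}^d\times\mathcal{P}_1(\mathbb{R}^d)\times\mathbb{R}^m\to\mathbb{R}^d$. Here $\mathcal{P}_1(\mathbb{R}^d)$ is the set of Borel probability measures $\mu$ on $\mathbb{R}^d$ with $\|\mu\|_1:=\int|x|\,\mu(dx)<\infty$, with the Wasserstein-1 distance $\mathcal{W}_1(\mu,\nu)=\inf E|X-Y|$ (infimum over all pairs of random variables with laws $\mu,\nu$), equivalently $\sup\{|\int\phi\,d\mu-\int\phi\,d\nu|:\phi \text{ 1-Lipschitz}\}$. Particle system: for each $N\ge1$, $\{X_0^{i,N}\}_{i=1}^N$ are exchangeable $\mathbb{R}^d$-valued random variables each with law $\mu_0\in\mathcal{P}_1(\mathbb{R}^d)$; $\{\epsilon_n^i:i\ge1,n\ge1\}$ are i.i.d. $\mathbb{R}^m$-valued with law $\theta$, independent of the initial conditions; and for $n\ge0$, $X_{n+1}^{i,N}=AX_n^{i,N}+\delta f(X_n^{i,N},\mu_n^N,\epsilon_{n+1}^i)$, $i=1,\dots,N$, where $\mu_n^N=\frac1N\sum_{i=1}^N\delta_{X_n^{i,N}}$.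 Nonlinear evolution: for $\mu\in\mathcal{P}_1(\mathbb{R}^d)$, $\Psi(\mu)$ is the law of $AX+\delta f(X,\mu,\epsilon)$ where $(X,\epsilon)$ has law $\mu\otimes\theta$; $\mu_{n+1}=\Psi(\mu_n)$ for $n\ge0$, and $\Psi^n$ denotes the $n$-fold composition. Assumption (A1): $\sigma:=\int D(z)\theta(dz)<\infty$, where $D(z):=\sup\frac{|f(x_1,\mu_1,z)-f(x_2,\mu_2,z)|}{|x_1-x_2|+\mathcal{W}_1(\mu_1,\mu_2)}$, the supremum over $(x_1,\mu_1)\neq(x_2,\mu_2)$ in $\mathbb{R}^d\times\mathcal{P}_1(\mathbb{R}^d)$. Assumption (A2): $c_0:=\int D_1(z)\theta(dz)<\infty$, where $D_1(z):=|f(0,\delta_0,z)|$. *)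

(* Defs.v *)
From HB Require Import structures.
From mathcomp Require Import all_boot all_order all_algebra all_fingroup.
From mathcomp Require Import all_classical all_reals all_analysis.
From mathcomp Require Import giry perm.

Set Implicit Arguments.
Unset Strict Implicit.
Unset Printing Implicit Defensive.

Import Order.TTheory GRing.Theory Num.Theory.
Local Open Scope classical_set_scope.
Local Open Scope ring_scope.

Section Defs.
Variable R : realType.

(* R^d is modelled by d.-tuple R, with its library (product Borel) sigma-algebra. *)
Definition vzero d : d.-tuple R := [tuple (0 : R) | _ < d].
Definition vadd d (x y : d.-tuple R) : d.-tuple R := [tuple tnth x i + tnth y i | i < d].
Definition vsub d (x y : d.-tuple R) : d.-tuple R := [tuple tnth x i - tnth y i | i < d].
Definition vscale d (c : R) (x : d.-tuple R) : d.-tuple R := [tuple c * tnth x i | i < d].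
Definition mxv d (A : 'M[R]_d) (x : d.-tuple R) : d.-tuple R :=
  [tuple \sum_(j < d) A i j * tnth x j | i < d].
Definition enorm d (x : d.-tuple R) : R := Num.sqrt (\sum_(i < d) tnth x i ^+ 2).

Definition lip1 d (phi : d.-tuple R -> R) : Prop :=
  forall x y, `|phi x - phi y| <= enorm (vsub x y).

(* Wasserstein-1 distance in its Kantorovich--Rubinstein (dual) form. *)
Definition W1 d (mu nu : set (d.-tuple R) -> \bar R) : \bar R :=
  ereal_sup [set `| (\int[mu]_x (phi x)%:E - \int[nu]_x (phi x)%:E)%E |%E
            | phi in [set phi : d.-tuple R -> R | lip1 phi]].

Definition inP1 d (mu : set (d.-tuple R) -> \bar R) : Prop :=
  mu setT = 1%E /\ (\int[mu]_x (enorm x)%:E < +oo)%E.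

(* empirical measure (1/N) sum_{i<N} delta_{x i} (for N >= 1) *)
Definition empirical d (N : nat) (x : nat -> d.-tuple R) : probability (d.-tuple R) R :=
  mnormalize (msum (fun i => @dirac _ (d.-tuple R) (x i) R) N) (@dirac _ _ (vzero d) R).

(* D(z) of Assumption (A1): sup over (x1,mu1) <> (x2,mu2) in R^d x P_1(R^d) *)
Definition Dlip d m (f : d.-tuple R -> giry (d.-tuple R) R -> m.-tuple R -> d.-tuple R)
  (z : m.-tuple R) : \bar R :=
  ereal_sup [set ((enorm (vsub (f p.1.1 p.1.2 z) (f p.2.1 p.2.2 z)))%:E
                  / ((enorm (vsub p.1.1 p.2.1))%:E + W1 p.1.2 p.2.2))%E
            | p in [set p : (d.-tuple R * giry (d.-tuple R) R) * (d.-tuple R * giry (d.-tuple R) R)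
                   | inP1 p.1.2 /\ inP1 p.2.2 /\
                     ((enorm (vsub p.1.1 p.2.1))%:E + W1 p.1.2 p.2.2 > 0)%E]].

(* Particle system: X_{n+1}^{i,N} = A X_n^{i,N} + delta f(X_n^{i,N}, mu_n^N, eps_{n+1}^i),
   particles indexed by i = 0..N-1, noise eps_{n+1}^i written eps n i. *)
Fixpoint particles d m (Omega : Type) (A : 'M[R]_d) (delta : R)
  (f : d.-tuple R -> giry (d.-tuple R) R -> m.-tuple R -> d.-tuple R)
  (X0 : nat -> nat -> Omega -> d.-tuple R) (eps : nat -> nat -> Omega -> m.-tuple R)
  (N n : nat) : nat -> Omega -> d.-tuple R :=
  match n with
  | 0 => X0 N
  | n'.+1 => fun i w =>
      let x := particles A delta f X0 eps N n' in
      vadd (mxv A (x i w)) (vscale delta (f (x i w) (empirical N (fun j => x j w)) (eps n' i w)))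
  end.

Definition nonlinear_flow d m (A : 'M[R]_d) (delta : R)
  (f : d.-tuple R -> giry (d.-tuple R) R -> m.-tuple R -> d.-tuple R)
  (theta : probability (m.-tuple R) R) (mu0 : probability (d.-tuple R) R)
  (mu : nat -> probability (d.-tuple R) R) : Prop :=
  mu 0%N = mu0 /\
  forall n (B : set (d.-tuple R)), measurable B ->
    mu n.+1 B = ((mu n : set _ -> \bar R) \x (theta : set _ -> \bar R))%E
       ((fun p : d.-tuple R * m.-tuple R =>
           vadd (mxv A p.1) (vscale delta (f p.1 (mu n) p.2))) @^-1` B).

(* {eps_n^i} i.i.d. with law theta and independent of all the initial conditions
   {X_0^{i,N} : i < N, N >= 1}: product rule over every finite subfamily. *)
Definition noise_iid_indep d m dO (Omega : measurableType dO) (P : probability Omega R)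
  (theta : probability (m.-tuple R) R)
  (X0 : nat -> nat -> Omega -> d.-tuple R) (eps : nat -> nat -> Omega -> m.-tuple R) : Prop :=
  forall (J K : seq (nat * nat)) (B : nat * nat -> set (m.-tuple R))
         (C : nat * nat -> set (d.-tuple R)),
    uniq J -> all (fun k => (k.2 < k.1)%N) K ->
    (forall j, measurable (B j)) -> (forall k, measurable (C k)) ->
    P ((\bigcap_(j in [set` J]) (eps j.1 j.2 @^-1` B j))
       `&` (\bigcap_(k in [set` K]) (X0 k.1 k.2 @^-1` C k)))
    = (\big[*%E/1%E]_(j <- J) theta (B j)
       * P (\bigcap_(k in [set` K]) (X0 k.1 k.2 @^-1` C k)))%E.

Definition exchangeable_init d dO (Omega : measurableType dO) (P : probability Omega R)
  (X0 : nat -> nat -> Omega -> d.-tuple R) : Prop :=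
  forall N (s : 'S_N) (C : 'I_N -> set (d.-tuple R)), (forall i, measurable (C i)) ->
    P (\bigcap_(i in [set: 'I_N]) (X0 N (s i) @^-1` C i))
    = P (\bigcap_(i in [set: 'I_N]) (X0 N i @^-1` C i)).
End Defs.

(* Main.v *)
(* The interacting particles X are coupled with particles Y which start from the same
   initial data, use the same noise, but feel the deterministic flow mu_n instead of the
   empirical measure.  Each Y_n^i has law exactly mu_n.  Given the past, the Y_{n+1}^i
   are independent, so the fluctuations of their empirical averages have variance at
   most 1/N; by induction on n the empirical averages of Lipschitz [0,1]-valued
   observables converge in mean.  A Lipschitz partition of unity over a dense sequence,
   together with the fixed tail of mu_n, upgrades this to convergence of
   W1(empirical Y, mu_n).  The coupling error a_n = E |X_n - Y_n| (averaged over
   particles) satisfies a_{n+1} <= (C + 2 delta sigma) a_n + delta sigma E U_n, where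
   U_n dominates W1(empirical Y, mu_n); hence a_n -> 0.

   Neither [Dlip f] nor [w |-> W1 (empirical ..) mu] is known to be measurable; the
   integral of a nonnegative function is then a lower integral, and only its
   monotonicity is used. *)
Require Import Defs.
From HB Require Import structures.
From mathcomp Require Import all_boot all_order all_algebra.
From mathcomp Require Import all_classical all_reals all_analysis.
From mathcomp Require Import giry perm.
From mathcomp Require Import measurable_realfun ring lra.

Set Implicit Arguments.
Unset Strict Implicit.
Unset Printing Implicit Defensive.

Import Order.TTheory GRing.Theory Num.Theory.
Import numFieldNormedType.Exports.
Local Open Scope classical_set_scope.
Local Open Scope ring_scope.

(** * Euclidean geometry of tuples *)

Section euclidean_norm.
Context {R : realType}.
Implicit Type d : nat.

(** Only first moments are available, so a Lipschitz observable may have infinite variance; this is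
    why the mean-square estimate is confined to bounded observables and the rest is left to a tail.
    That tail must be small uniformly in [N]: the law of [X_n^i] varies with [N], that of [Y_n^i]
    does not. The initial values need not be independent, hence neither need the [Y_n^i] be; what is
    exploited is the independence of a new noise from the past, each new variable being compared
    with its conditional mean. This conditional mean is again a Lipschitz [0,1]-valued observable
    one step earlier, so the induction runs over all such observables at once. Since X and Y agree
    at time 0, the assumed convergence of the initial empirical measures acts elsewhere: it is the
    base case for the observables of Y. Conditioning is expressed by integrating a noise variable
    with the past frozen, and adaptedness by measurability for a coarser sigma-algebra on
    [Omega]. *)

Lemma enorm_ge0 d (x : d.-tuple R) : 0 <= enorm x.
Proof. exact: sqrtr_ge0. Qed.

Lemma sqr_enorm d (x : d.-tuple R) : enorm x ^+ 2 = \sum_(i < d) tnth x i ^+ 2.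
Proof. by rewrite sqr_sqrtr// sumr_ge0// => i _; exact: sqr_ge0. Qed.

Lemma ler_norm_tnth_enorm d (x : d.-tuple R) i : `|tnth x i| <= enorm x.
Proof.
rewrite -sqrtr_sqr ler_wsqrtr// (bigD1 i)//= lerDl sumr_ge0// => j _.
exact: sqr_ge0.
Qed.

Lemma enorm_le_sum d (x : d.-tuple R) : enorm x <= \sum_(i < d) `|tnth x i|.
Proof.
have S0 : 0 <= \sum_(i < d) `|tnth x i| by exact: sumr_ge0.
rewrite -(ger0_norm S0) -sqrtr_sqr ler_wsqrtr//.
rewrite expr2 mulr_suml ler_sum// => i _.
rewrite -real_normK ?num_real// expr2 ler_wpM2l//.
by rewrite (bigD1 i)//= lerDl sumr_ge0.
Qed.

(** After normalising both vectors, [ab <= (a^2 + b^2) / 2] holds in each coordinate and the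
    right-hand sides add up to 1. *)
Lemma cauchy_schwarz_tuple d (x y : d.-tuple R) :
  \sum_(i < d) tnth x i * tnth y i <= enorm x * enorm y.
Proof.
have [x0|xn0] := eqVneq (enorm x) 0.
  rewrite x0 mul0r big1// => i _.
  have := ler_norm_tnth_enorm x i; rewrite x0 normr_le0 => /eqP ->.
  by rewrite mul0r.
have [y0|yn0] := eqVneq (enorm y) 0.
  rewrite y0 mulr0 big1// => i _.
  have := ler_norm_tnth_enorm y i; rewrite y0 normr_le0 => /eqP ->.
  by rewrite mulr0.
have xp : 0 < enorm x by rewrite lt_def xn0 enorm_ge0.
have yp : 0 < enorm y by rewrite lt_def yn0 enorm_ge0.
have : \sum_(i < d) (tnth x i / enorm x) * (tnth y i / enorm y) <=
    \sum_(i < d) ((tnth x i ^+ 2 / enorm x ^+ 2) + (tnth y i ^+ 2 / enorm y ^+ 2)) / 2.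
  apply: ler_sum => i _.
  rewrite -!expr_div_n.
  set a := tnth x i / _; set b := tnth y i / _.
  by have := sqr_ge0 (a - b); nra.
rewrite -mulr_suml big_split/= -!mulr_suml -!sqr_enorm.
under eq_bigr do rewrite mulrACA -invfM.
rewrite -mulr_suml !divff ?expf_neq0//.
by rewrite ler_pdivrMr ?mulr_gt0// mul1r.
Qed.

Lemma enorm_vadd d (x y : d.-tuple R) : enorm (vadd x y) <= enorm x + enorm y.
Proof.
rewrite -(ler_pXn2r (n:=2))// ?nnegrE ?addr_ge0 ?enorm_ge0//.
rewrite sqrrD !sqr_enorm.
rewrite (eq_bigr (fun i => tnth x i ^+ 2 + (tnth x i * tnth y i) *+ 2 + tnth y i ^+ 2)); last first.
  by move=> i _; rewrite tnth_mktuple sqrrD.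
rewrite !big_split/= lerD2r lerD2l mulr2n.
by rewrite lerD ?cauchy_schwarz_tuple.
Qed.

Lemma enorm_vscale d (c : R) (x : d.-tuple R) : enorm (vscale c x) = `|c| * enorm x.
Proof.
rewrite /enorm -sqrtr_sqr -sqrtrM ?sqr_ge0//; congr Num.sqrt.
by rewrite mulr_sumr; apply: eq_bigr => i _; rewrite tnth_mktuple exprMn.
Qed.

Lemma enorm_vsubxx d (x : d.-tuple R) : enorm (vsub x x) = 0.
Proof.
by rewrite /enorm big1 ?sqrtr0// => i _; rewrite tnth_mktuple subrr expr0n.
Qed.

Lemma enorm_vsubC d (x y : d.-tuple R) : enorm (vsub x y) = enorm (vsub y x).
Proof.
congr Num.sqrt; apply: eq_bigr => i _.
by rewrite !tnth_mktuple -sqrrN opprB.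
Qed.

Lemma vsubx0 d (x : d.-tuple R) : vsub x (@vzero R d) = x.
Proof. by apply: eq_from_tnth => i; rewrite !tnth_mktuple subr0. Qed.

Lemma enorm_vsub_trans d (y x z : d.-tuple R) :
  enorm (vsub x z) <= enorm (vsub x y) + enorm (vsub y z).
Proof.
rewrite (_ : vsub x z = vadd (vsub x y) (vsub y z)) ?enorm_vadd//.
by apply: eq_from_tnth => i; rewrite !tnth_mktuple addrA subrK.
Qed.

Lemma ler_enorm_dist d (x y : d.-tuple R) :
  `|enorm x - enorm y| <= enorm (vsub x y).
Proof.
have := enorm_vsub_trans y x (@vzero R d).
have := enorm_vsub_trans x y (@vzero R d).
rewrite !vsubx0 (enorm_vsubC y x) ler_norml => h1 h2; apply/andP; split; lra.
Qed.

Lemma enorm_dim0 d (x : d.-tuple R) : d = 0%N -> enorm x = 0.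
Proof. by move=> d0; rewrite d0 in x *; rewrite /enorm big_ord0 sqrtr0. Qed.

(** A crude bound for the operator norm: with [n] fixed, any finite growth constant per step is
    enough. *)
Definition mxbound d (A : 'M[R]_d) := \sum_(i < d) \sum_(j < d) `|A i j|.

Lemma mxbound_ge0 d (A : 'M[R]_d) : 0 <= mxbound A.
Proof. by rewrite sumr_ge0// => i _; rewrite sumr_ge0. Qed.

Lemma enorm_mxv d (A : 'M[R]_d) x : enorm (mxv A x) <= mxbound A * enorm x.
Proof.
rewrite (le_trans (enorm_le_sum _))// mulr_suml ler_sum// => i _.
rewrite tnth_mktuple (le_trans (ler_norm_sum _ _ _))// mulr_suml ler_sum// => j _.
by rewrite normrM ler_wpM2l// ler_norm_tnth_enorm.
Qed.

(** Convertible with the body of the recursion in [particles], so that estimates on [step] apply to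
    it directly. *)
Definition step d (A : 'M[R]_d) (delta : R) (x y : d.-tuple R) : d.-tuple R :=
  vadd (mxv A x) (vscale delta y).

Lemma enorm_step d (A : 'M[R]_d) delta x y : 0 <= delta ->
  enorm (step A delta x y) <= mxbound A * enorm x + delta * enorm y.
Proof.
move=> d0; rewrite (le_trans (enorm_vadd _ _))// lerD ?enorm_mxv//.
by rewrite enorm_vscale ger0_norm.
Qed.

Lemma step_vsub d (A : 'M[R]_d) delta x y x' y' :
  vsub (step A delta x y) (step A delta x' y') = step A delta (vsub x x') (vsub y y').
Proof.
apply: eq_from_tnth => i; rewrite !tnth_mktuple.
rewrite [X in _ = X + _](_ : _ = \sum_(j < d) A i j * tnth x j - \sum_(j < d) A i j * tnth x' j).
  by rewrite mulrBr opprD addrACA.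
by rewrite -sumrB; apply: eq_bigr => j _; rewrite tnth_mktuple mulrBr.
Qed.

Lemma enorm_step_vsub d (A : 'M[R]_d) delta x y x' y' : 0 <= delta ->
  enorm (vsub (step A delta x y) (step A delta x' y')) <=
  mxbound A * enorm (vsub x x') + delta * enorm (vsub y y').
Proof. by move=> d0; rewrite step_vsub enorm_step. Qed.

(** Enumeration of the rational points; integers coding no tuple are sent to the origin. *)
Definition ratpt d (k : nat) : d.-tuple R :=
  [tuple ratr (tnth (odflt [tuple (0%Q : rat) | _ < d] (unpickle k)) i) | i < d].

Lemma ratpt_dense d (x : d.-tuple R) e : 0 < e ->
  exists k, enorm (vsub x (ratpt d k)) < e.
Proof.
move=> e0.
(* Dividing by [d.+1] covers dimension 0 and leaves the sum of [d] terms strictly below [e]. *)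
have e'0 : 0 < e / d.+1%:R by rewrite divr_gt0.
have h i : exists q : rat, `|tnth x i - ratr q| < e / d.+1%:R.
  have [q] : exists q, ratr q \in `]tnth x i - e / d.+1%:R, tnth x i[.
    by apply: rat_in_itvoo; rewrite ltrBlDr ltrDl.
  rewrite in_itv/= => /andP[h1 h2]; exists q.
  by rewrite gtr0_norm ?subr_gt0// ltrBlDr addrC -ltrBlDr.
pose q := [tuple sval (cid (h i)) | i < d].
exists (pickle q).
rewrite (le_lt_trans (enorm_le_sum _))//.
rewrite (@le_lt_trans _ _ (\sum_(i < d) (e / d.+1%:R)))//.
  apply: ler_sum => i _; rewrite !tnth_mktuple pickleK/= tnth_mktuple.
  by case: cid => //= p /ltW.
rewrite sumr_const card_ord -[ltLHS]mulr_natr -mulrA gtr_pMr//.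
by rewrite ltr_pdivrMl// mulr1 ltr_nat.
Qed.

End euclidean_norm.

Section measurability.
Context {R : realType}.

Lemma measurable_enorm d : measurable_fun setT (@enorm R d).
Proof.
apply: (measurableT_comp (continuous_measurable_fun (@sqrt_continuous R))).
apply: measurable_sum => i.
by apply: measurable_funX; exact: measurable_tnth.
Qed.

Lemma measurable_vsub dT (T : measurableType dT) d (u v : T -> d.-tuple R) :
  measurable_fun setT u -> measurable_fun setT v ->
  measurable_fun setT (fun t => vsub (u t) (v t)).
Proof.
move=> mu mv; apply/measurable_fun_tnthP => i.
rewrite (_ : _ \o _ = fun t => tnth (u t) i - tnth (v t) i); last first.
  by apply/funext => t/=; rewrite tnth_mktuple.
by apply: measurable_funB; [exact: (iffLR (measurable_fun_tnthP _) mu)|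
  exact: (iffLR (measurable_fun_tnthP _) mv)].
Qed.

Lemma measurable_step dT (T : measurableType dT) d (A : 'M[R]_d) delta
    (u v : T -> d.-tuple R) :
  measurable_fun setT u -> measurable_fun setT v ->
  measurable_fun setT (fun t => step A delta (u t) (v t)).
Proof.
move=> mu mv; apply/measurable_fun_tnthP => i.
rewrite (_ : _ \o _ = fun t => \sum_(j < d) A i j * tnth (u t) j + delta * tnth (v t) i); last first.
  by apply/funext => t/=; rewrite !tnth_mktuple.
apply: measurable_funD.
  apply: measurable_sum => j; apply: measurable_funM => //.
  exact: (iffLR (measurable_fun_tnthP _) mu).
apply: measurable_funM => //.
exact: (iffLR (measurable_fun_tnthP _) mv).
Qed.

Definition lipw d (L : R) (phi : d.-tuple R -> R) :=
  forall x y, `|phi x - phi y| <= L * enorm (vsub x y).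

(* By McShane's formula [phi x = inf_k (phi q_k + L |x - q_k|)] over a dense sequence. *)
Lemma measurable_lipw d L (phi : d.-tuple R -> R) :
  lipw L phi -> measurable_fun setT phi.
Proof.
move=> lphi.
wlog L0 : L lphi / 0 < L.
  move=> h; apply: (h (`|L| + 1)) => [x y|]; last by rewrite ltr_wpDl.
  rewrite (le_trans (lphi x y))// ler_wpM2r ?enorm_ge0//.
  by rewrite (le_trans (ler_norm _))// lerDl.
apply: (measurability _ (RGenInftyO.measurableE R)) => //= _ [_ [c ->] <-].
rewrite setTI (_ : _ @^-1` _ =
  \bigcup_k [set x | phi (ratpt d k) + L * enorm (vsub x (ratpt d k)) < c]).
  apply: bigcup_measurable => k _.
  rewrite (_ : [set x | _] = setT `&` 
    (fun x => phi (ratpt d k) + L * enorm (vsub x (ratpt d k))) @^-1` `]-oo, c[); last first.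
    by rewrite setTI; apply/seteqP; split => x/=; rewrite in_itv.
  have : measurable_fun setT (fun x => phi (ratpt d k) + L * enorm (vsub x (ratpt d k))).
    apply: measurable_funD => //; apply: measurable_funM => //.
    apply: (measurableT_comp (@measurable_enorm d)).
    exact: measurable_vsub.
  by apply => //; exact: measurable_itv.
apply/seteqP; split => [x/=|x [k _]/=]; rewrite in_itv/=; last first.
  apply: le_lt_trans; rewrite addrC -lerBlDr.
  by rewrite (le_trans (ler_norm _)).
move=> xc.
(* Since [phi q <= phi x + L |x - q|], the term at [q] is at most [phi x + 2 L |x - q|], whence this
   radius. *)
have [k kx] : exists k, enorm (vsub x (ratpt d k)) < (c - phi x) / (2 * L).
  by apply: ratpt_dense; rewrite divr_gt0 ?subr_gt0 ?mulr_gt0.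
exists k => //=; rewrite ltr_pdivlMr ?mulr_gt0// in kx.
have := le_trans (ler_norm _) (lphi (ratpt d k) x); rewrite enorm_vsubC.
by nra.
Qed.
End measurability.

(** * Wasserstein distance and empirical measures *)

(** The integral of a nonnegative function, measurable or not, is a supremum over the simple
    functions below it, and those below [f] are below [g]. *)
Lemma le_lower_integral dT (T : measurableType dT) (R : realType)
    (mu : {measure set T -> \bar R}) (f g : T -> \bar R) :
  (forall x, 0 <= f x)%E -> (forall x, f x <= g x)%E ->
  (\int[mu]_x f x <= \int[mu]_x g x)%E.
Proof.
move=> f0 fg; rewrite !ge0_integralTE//; last by move=> x; exact: le_trans (fg x).
by apply: le_ereal_sup => _ [h hf <-]; exists h => // x; exact: le_trans (fg x).
Qed.

Lemma probability_integral_cst dT (T : measurableType dT) (R : realType)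
    (P : probability T R) (r : R) :
  (\int[P]_x r%:E = r%:E)%E.
Proof.
by have := integral_cst P measurableT r%:E; rewrite /= probability_setT mule1.
Qed.

Lemma bounded_integrable dT (T : measurableType dT) (R : realType)
    (P : probability T R) (h : T -> R) (M : R) :
  measurable_fun setT h -> (forall x, `|h x| <= M) -> P.-integrable setT (EFin \o h).
Proof.
move=> mh hM; apply: (@le_integrable _ _ _ P setT measurableT _ (EFin \o cst M)).
- exact/measurable_EFinP.
- by move=> x _; rewrite /= lee_fin (le_trans (hM x))// ler_norm.
- exact: finite_measure_integrable_cst.
Qed.

Lemma Rintegral_sum dT (T : measurableType dT) (R : realType)
    (mu : {measure set T -> \bar R}) I (r : seq I) (h : I -> T -> R) :
  (forall i, mu.-integrable setT (EFin \o h i)) ->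
  \int[mu]_x (\sum_(i <- r) h i x) = \sum_(i <- r) \int[mu]_x h i x.
Proof.
move=> ih; rewrite /Rintegral.
under eq_integral do rewrite -sumEFin.
rewrite integral_sum//=.
rewrite (eq_bigr (fun i => (\int[mu]_x h i x)%:E)) ?sumEFin//.
by move=> i _; rewrite fineK//; exact: integrable_fin_num (ih i).
Qed.

Section wasserstein.
Context {R : realType} {d : nat}.
Implicit Types (x : nat -> d.-tuple R).

Definition avg (N : nat) (a : nat -> R) : R := N%:R^-1 * \sum_(i < N) a i.

Lemma avg_ge0 N a : (forall i, (i < N)%N -> 0 <= a i) -> 0 <= avg N a.
Proof. by move=> a0; rewrite mulr_ge0// sumr_ge0// => i _; exact: a0. Qed.

Lemma ler_avg N a b : (forall i, (i < N)%N -> a i <= b i) -> avg N a <= avg N b.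
Proof. by move=> ab; rewrite ler_wpM2l// ler_sum// => i _; exact: ab. Qed.

Lemma eq_avg N a b : (forall i, (i < N)%N -> a i = b i) -> avg N a = avg N b.
Proof. by move=> ab; congr (_ * _); apply: eq_bigr => i _; exact: ab. Qed.

Lemma avgD N a b : avg N (fun i => a i + b i) = avg N a + avg N b.
Proof. by rewrite /avg big_split/= mulrDr. Qed.

Lemma avgB N a b : avg N (fun i => a i - b i) = avg N a - avg N b.
Proof. by rewrite /avg sumrB mulrBr. Qed.

Lemma avgZ N k a : avg N (fun i => k * a i) = k * avg N a.
Proof. by rewrite /avg -mulr_sumr mulrCA. Qed.

Lemma avg_cst N k : (0 < N)%N -> avg N (fun=> k) = k.
Proof.
move=> N0; rewrite /avg sumr_const card_ord -[k *+ N]mulr_natl mulKf//.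
by rewrite pnatr_eq0 -lt0n.
Qed.

Lemma ler_norm_avg N a : `|avg N a| <= avg N (fun i => `|a i|).
Proof. by rewrite /avg normrM ger0_norm// ler_wpM2l// ler_norm_sum. Qed.

(** [mnormalize] resorts to its default Dirac mass only when the total mass is 0 or infinite; here
    it is [N]. *)
Lemma empiricalE N x B : (0 < N)%N -> empirical N x B =
  ((N%:R^-1)%:E * msum (fun i => @dirac _ (d.-tuple R) (x i) R) N B)%E.
Proof.
move=> N0; have NN0 : N%:R != 0 :> R by rewrite pnatr_eq0 -lt0n.
rewrite /empirical/= /mnormalize/=.
have -> : msum (fun i => @dirac _ (d.-tuple R) (x i) R) N setT = N%:R%:E.
  rewrite /msum/= (eq_bigr (fun=> 1%:E)); last by move=> i _; rewrite diracT.
  by rewrite sumEFin sumr_const card_ord.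
by rewrite eqe (negbTE NN0)/= muleC.
Qed.

(** Additivity of the integral in the measure is applied to nonnegative integrands, so a signed
    [phi] is split into its positive and negative parts, whose averages are finite. *)
Lemma integral_empirical N x (phi : d.-tuple R -> R) : (0 < N)%N ->
  measurable_fun setT phi ->
  (\int[empirical N x]_y (phi y)%:E = (avg N (fun i => phi (x i)))%:E)%E.
Proof.
move=> N0.
have nng (psi : d.-tuple R -> R) : measurable_fun setT psi -> (forall y, 0 <= psi y) ->
    (\int[empirical N x]_y (psi y)%:E = (avg N (fun i => psi (x i)))%:E)%E.
  move=> mpsi psi0.
  have iN0 : 0 <= N%:R^-1 :> R by rewrite invr_ge0.
  rewrite (eq_measure_integral (mscale (NngNum iN0)
    (msum (fun i => @dirac _ (d.-tuple R) (x i) R) N))); last first.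
    by move=> B mB _; rewrite [LHS]empiricalE.
  rewrite ge0_integral_mscale//=; [|exact/measurable_EFinP|by move=> y _; rewrite lee_fin].
  rewrite ge0_integral_measure_sum//=; [|by move=> y _; rewrite lee_fin|exact/measurable_EFinP].
  rewrite (eq_bigr (fun i : 'I_N => (psi (x i))%:E)).
    by rewrite sumEFin -EFinM.
  move=> i _; rewrite integral_dirac//; last exact/measurable_EFinP.
  by rewrite diracT mul1e.
move=> mphi; rewrite integralE.
under eq_integral do rewrite funeposE -EFin_max.
under [X in (_ - X)%E]eq_integral do rewrite funenegE -EFinN -EFin_max.
rewrite !nng.
- rewrite -EFinB -avgB; congr EFin; apply: eq_avg => i _ /=.
  have [h|/ltW h] := leP 0 (phi (x i)).
    by rewrite (max_idPr _) ?subr0// oppr_le0.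
  by rewrite (max_idPl _) ?oppr_ge0// sub0r opprK.
- by apply: measurable_maxr => //; exact: measurable_funN.
- by move=> y; rewrite le_max lexx orbT.
- exact: measurable_maxr.
- by move=> y; rewrite le_max lexx orbT.
Qed.

Lemma inP1_empirical N x : (0 < N)%N -> inP1 (empirical N x).
Proof.
move=> N0; split; first exact: probability_setT.
by rewrite integral_empirical ?ltry//; exact: measurable_enorm.
Qed.

Lemma inP1_dirac (a : d.-tuple R) : inP1 (@dirac _ _ a R).
Proof.
split; first by rewrite diracT.
rewrite integral_dirac//; first by rewrite diracT mul1e ltry.
by apply/measurable_EFinP; exact: measurable_enorm.
Qed.

Lemma lipw_integrable (mu : {finite_measure set (d.-tuple R) -> \bar R}) L (phi : d.-tuple R -> R) :
  inP1 mu -> lipw L phi -> mu.-integrable setT (EFin \o phi).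
Proof.
move=> [_ muP] lphi.
pose z := @vzero R d.
apply: (@le_integrable _ _ _ _ _ _ _ (fun y => (`|phi z| + `|L| * enorm y)%:E)) => //.
- by apply/measurable_EFinP; exact: measurable_lipw lphi.
- move=> y _ /=; rewrite lee_fin.
  rewrite [leRHS]ger0_norm ?addr_ge0 ?mulr_ge0 ?enorm_ge0//.
  rewrite -lerBlDl (le_trans (lerB_dist _ _))// (le_trans (lphi _ _))//.
  by rewrite vsubx0 ler_wpM2r ?enorm_ge0// ler_norm.
- apply: (@integrableD _ _ _ _ _ _ (cst (`|phi z|%:E)) (fun y => (`|L| * enorm y)%:E)) => //.
    exact: finite_measure_integrable_cst.
  apply: (@integrableZl _ _ _ _ _ _ `|L| (EFin \o @enorm R d)) => //.
  apply/integrableP; split; first by apply/measurable_EFinP; exact: measurable_enorm.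
  under eq_integral do rewrite /= ger0_norm ?enorm_ge0//.
  by [].
Qed.

Lemma W1_ge0 (mu nu : set (d.-tuple R) -> \bar R) : (0 <= W1 mu nu)%E.
Proof.
apply: le_trans (ereal_sup_ubound _); last first.
  by exists (cst 0) => // y z; rewrite subrr normr0 enorm_ge0.
exact: abse_ge0.
Qed.

Lemma lip1_lipw (phi : d.-tuple R -> R) : lip1 phi -> lipw 1 phi.
Proof. by move=> h y z; rewrite mul1r. Qed.

(** The moment condition makes the integral of [phi] finite; in the extended reals an infinite value
    minus itself would not be 0. *)
Lemma W1xx (mu : {finite_measure set (d.-tuple R) -> \bar R}) : inP1 mu -> (W1 mu mu <= 0)%E.
Proof.
move=> muP; apply: ge_ereal_sup => _ [phi /lip1_lipw lphi <-].
rewrite subee ?abse0//.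
by apply: integrable_fin_num => //; exact: lipw_integrable lphi.
Qed.

Lemma W1_dirac0 (mu : probability (d.-tuple R) R) : inP1 mu ->
  (W1 mu (@dirac _ _ (@vzero R d) R) <= \int[mu]_y (enorm y)%:E)%E.
Proof.
move=> muP; apply: ge_ereal_sup => _ [phi lphi <-].
have lwphi := lip1_lipw lphi.
have mphi : measurable_fun setT (EFin \o phi).
  by apply/measurable_EFinP; exact: measurable_lipw lwphi.
rewrite integral_dirac// diracT mul1e.
have -> : (phi (@vzero R d))%:E = (\int[mu]_y (cst (phi (@vzero R d))%:E y))%E.
  by rewrite [RHS]probability_integral_cst.
rewrite -integralB//; [|exact: lipw_integrable lwphi|exact: finite_measure_integrable_cst].
apply: le_trans (le_abse_integral _ _ _) _ => //.
  by apply: emeasurable_funB.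
apply: ge0_le_integral => //.
- by apply: measurableT_comp => //; exact: emeasurable_funB.
- by apply/measurable_EFinP; exact: measurable_enorm.
- by move=> y _; rewrite -EFinB lee_fin -[leRHS](congr1 (@enorm R d) (vsubx0 y)).
Qed.

End wasserstein.

(** * The kernel averaged over the noise is Lipschitz *)

Section lipschitz_kernel.
Context {R : realType} {d m : nat}.
Variables (theta : probability (m.-tuple R) R)
  (f : d.-tuple R -> giry (d.-tuple R) R -> m.-tuple R -> d.-tuple R).
Hypothesis mf : measurable_fun [set: (d.-tuple R * giry (d.-tuple R) R) * m.-tuple R]
    (fun p => f p.1.1 p.1.2 p.2).

Lemma measurable_kernel_section x mu : measurable_fun setT (f x mu).
Proof.
apply: (measurableT_comp mf (g := fun z => ((x, mu), z))).
exact: measurable_pair1.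
Qed.

Lemma measurable_kernel_dist x mu y nu :
  measurable_fun setT (fun z => (enorm (vsub (f x mu z) (f y nu z)))%:E).
Proof.
apply/measurable_EFinP; apply: (measurableT_comp (@measurable_enorm R d)).
by apply: measurable_vsub; exact: measurable_kernel_section.
Qed.

Hypothesis Df : (\int[theta]_z Dlip f z < +oo)%E.

(** In dimension 0 the supremum defining [Dlip] runs over an empty set and is [-oo]; the maximum
    with 0 keeps [s] a nonnegative bound for the integral. *)
Let s := fine (maxe 0%E (\int[theta]_z Dlip f z)%E).

Lemma Dlip_const_ge0 : 0 <= s.
Proof. by rewrite fine_ge0// le_max lexx. Qed.

Let kernel_dist x mu y nu := (\int[theta]_z (enorm (vsub (f x mu z) (f y nu z)))%:E)%E.

(** The real [r] is any upper bound of the Wasserstein distance, so that a measurable random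
    majorant can later replace a distance whose measurability is unknown. *)
Let kernel_dist_le_pos x y (mu nu : giry (d.-tuple R) R) r : inP1 mu -> inP1 nu ->
  (W1 mu nu <= r%:E)%E -> ((enorm (vsub x y))%:E + W1 mu nu > 0)%E ->
  (kernel_dist x mu y nu <= (s * (enorm (vsub x y) + r))%:E)%E.
Proof.
move=> muP nuP Wr c0.
have Wfin : W1 mu nu \is a fin_num.
  by rewrite ge0_fin_numE ?W1_ge0// (le_lt_trans Wr)// ltry.
pose c := enorm (vsub x y) + fine (W1 mu nu).
have cE : ((enorm (vsub x y))%:E + W1 mu nu = c%:E)%E by rewrite EFinD fineK.
rewrite cE lte_fin in c0.
have sE : (\int[theta]_z Dlip f z <= s%:E)%E.
  rewrite fineK; first by rewrite le_max lexx orbT.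
  by rewrite ge0_fin_numE ?le_max ?lexx// gt_max ltry Df.
apply: (@le_trans _ _ (s%:E * c%:E)%E); last first.
  rewrite -EFinM lee_fin ler_wpM2l ?Dlip_const_ge0// lerD2l.
  by rewrite -lee_fin fineK.
(* The constant is moved onto the kernel distance, which is measurable; [Dlip] itself is only
   compared pointwise under the lower integral. *)
rewrite muleC -lee_pdivrMl//.
apply: le_trans sE.
rewrite /kernel_dist -ge0_integralZl_EFin//; last 3 first.
- by move=> z _; rewrite lee_fin enorm_ge0.
- exact: measurable_kernel_dist.
- by rewrite invr_ge0 ltW.
apply: le_lower_integral => z; first by rewrite -EFinM lee_fin mulr_ge0 ?enorm_ge0// invr_ge0 ltW.
apply: ereal_sup_ubound; exists ((x, mu), (y, nu)) => /=.
  by do 2!split => //; rewrite cE lte_fin.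
by rewrite cE inver gt_eqF// muleC.
Qed.

(* When [|x - y| + W1 mu nu = 0] the supremum defining [Dlip] says nothing about the
   pair, so one goes through a third point [x'] at small positive distance of [x]. *)
Lemma kernel_dist_le x y (mu nu : giry (d.-tuple R) R) r : inP1 mu -> inP1 nu ->
  (W1 mu nu <= r%:E)%E ->
  (kernel_dist x mu y nu <= (s * (enorm (vsub x y) + r))%:E)%E.
Proof.
move=> muP nuP Wr.
have W0 := W1_ge0 mu nu.
have r0 : 0 <= r by rewrite -lee_fin (le_trans W0).
have [c0|] := ltP 0%E ((enorm (vsub x y))%:E + W1 mu nu)%E.
  exact: kernel_dist_le_pos.
rewrite -(fineK (_ : W1 mu nu \is a fin_num)); last first.
  by rewrite ge0_fin_numE// (le_lt_trans Wr)// ltry.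
rewrite -EFinD lee_fin => c0.
have Wf0 : 0 <= fine (W1 mu nu) by rewrite fine_ge0.
have xy0 : enorm (vsub x y) = 0 by have := enorm_ge0 (vsub x y); lra.
have Wfin : W1 mu nu \is a fin_num by rewrite ge0_fin_numE// (le_lt_trans Wr)// ltry.
have {}W0 : (W1 mu nu <= 0%:E)%E by rewrite -(fineK Wfin) lee_fin; lra.
rewrite xy0 add0r.
apply: (@le_trans _ _ 0%E); last by rewrite lee_fin mulr_ge0// Dlip_const_ge0.
(* In dimension 0 there is no other point to go through, but all distances vanish. *)
have [d0|d0] := posnP d.
  rewrite /kernel_dist integral0_eq// => z _.
  by rewrite enorm_dim0.
apply/lee_addgt0Pr => e e0; rewrite add0e.
(* Each of the two legs through [x'] costs at most [s * d * eta], so their total is at most [e];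
   [s + 1] avoids a division by 0. *)
pose eta := e / (2 * (s + 1) * d%:R).
have s0 := Dlip_const_ge0.
have dR0 : 0 < d%:R :> R by rewrite ltr0n.
have eta0 : 0 < eta by rewrite divr_gt0// !mulr_gt0//; lra.
pose v : d.-tuple R := [tuple eta | _ < d].
pose x' := vsub x v.
have xx'E : vsub x x' = v.
  by apply: eq_from_tnth => i; rewrite !tnth_mktuple opprB addrC subrK.
have v0 : 0 < enorm v.
  have := ler_norm_tnth_enorm v (Ordinal d0); apply: lt_le_trans.
  by rewrite tnth_mktuple gtr0_norm.
have vle : enorm v <= d%:R * eta.
  rewrite (le_trans (enorm_le_sum _))// (eq_bigr (fun=> eta)).
    by rewrite sumr_const card_ord -[eta *+ d]mulr_natl.
  by move=> i _; rewrite tnth_mktuple gtr0_norm.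
have x'y : enorm (vsub x' y) <= enorm v.
  by rewrite (le_trans (enorm_vsub_trans x _ _))// xy0 addr0 enorm_vsubC xx'E.
have x'y0 : 0 < enorm (vsub x' y).
  have := enorm_vsub_trans y x x'; rewrite xx'E xy0 add0r enorm_vsubC.
  exact: lt_le_trans.
(* The first leg moves only the point, the second then changes the measure; both pairs are
   admissible because [x'] is at positive distance from [x] and from [y]. *)
have h1 : (kernel_dist x mu x' mu <= (s * (enorm (vsub x x') + 0))%:E)%E.
  apply: kernel_dist_le_pos => //; first exact: W1xx.
  by rewrite xx'E (lt_le_trans (_ : 0 < (enorm v)%:E)%E)// ?lte_fin// leeDl// W1_ge0.
have h2 : (kernel_dist x' mu y nu <= (s * (enorm (vsub x' y) + 0))%:E)%E.
  apply: kernel_dist_le_pos => //.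
  by rewrite (lt_le_trans (_ : 0 < (enorm (vsub x' y))%:E)%E)// ?lte_fin// leeDl// W1_ge0.
apply: (@le_trans _ _ (kernel_dist x mu x' mu + kernel_dist x' mu y nu)%E).
  rewrite /kernel_dist -ge0_integralD//; last 4 first.
  - by move=> z _; rewrite lee_fin enorm_ge0.
  - exact: measurable_kernel_dist.
  - by move=> z _; rewrite lee_fin enorm_ge0.
  - exact: measurable_kernel_dist.
  apply: le_lower_integral => z; first by rewrite lee_fin enorm_ge0.
  by rewrite -EFinD lee_fin enorm_vsub_trans.
apply: le_trans (leeD h1 h2) _.
rewrite -EFinD lee_fin !addr0 xx'E.
apply: (@le_trans _ _ (2 * s * (d%:R * eta))).
  move: vle; set D := d%:R * eta => vle.
  rewrite (_ : 2 * s * D = s * (2 * D)); last by ring.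
  by rewrite -mulrDr ler_wpM2l// mulr_natl mulr2n lerD// (le_trans x'y vle).
apply: (@le_trans _ _ (2 * (s + 1) * (d%:R * eta))).
  have De0 : 0 <= d%:R * eta by rewrite mulr_ge0// ltW.
  by rewrite ler_wpM2r// ler_wpM2l// lerDl.
have s1 : s + 1 != 0 by rewrite gt_eqF// ltr_wpDl.
have dRn0 := lt0r_neq0 dR0.
by rewrite [leLHS](_ : _ = e)// /eta; field; rewrite s1 dRn0.
Qed.

End lipschitz_kernel.

(** * Reduction of the Wasserstein distance to finitely many observables *)

Section lipschitz_closure.
Context {R : realType} {d : nat}.
Implicit Types (phi psi : d.-tuple R -> R).

Lemma lipwD L M phi psi : lipw L phi -> lipw M psi ->
  lipw (L + M) (fun x => phi x + psi x).
Proof.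
move=> lphi lpsi x y; rewrite opprD addrACA mulrDl.
by rewrite (le_trans (ler_normD _ _))// lerD.
Qed.

Lemma lipwZ L k phi : lipw L phi -> lipw (`|k| * L) (fun x => k * phi x).
Proof. by move=> lphi x y; rewrite -mulrBr normrM -mulrA ler_wpM2l. Qed.

Lemma lipwB L M phi psi : lipw L phi -> lipw M psi ->
  lipw (L + M) (fun x => phi x - psi x).
Proof.
move=> lphi /(@lipwZ _ (-1)); rewrite normrN1 mul1r => lpsi x y.
by have := lipwD lphi lpsi x y; rewrite !mulN1r.
Qed.

Lemma lipw_cst k : lipw 0 (fun _ : d.-tuple R => k).
Proof. by move=> x y; rewrite subrr normr0 mul0r. Qed.

Lemma lipw_max L phi psi : lipw L phi -> lipw L psi ->
  lipw L (fun x => Num.max (phi x) (psi x)).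
Proof.
move=> lphi lpsi x y; have := lphi x y; have := lpsi x y.
rewrite !ler_norml => /andP[a b] /andP[p q].
by case: (leP (phi x)); case: (leP (phi y)) => h k; apply/andP; split; lra.
Qed.

Lemma lipw_min L phi psi : lipw L phi -> lipw L psi ->
  lipw L (fun x => Num.min (phi x) (psi x)).
Proof.
move=> lphi lpsi x y; have := lphi x y; have := lpsi x y.
rewrite !ler_norml => /andP[a b] /andP[p q].
by case: (leP (phi x)); case: (leP (phi y)) => h k; apply/andP; split; lra.
Qed.

Lemma lipwS L M phi : L <= M -> lipw L phi -> lipw M phi.
Proof.
by move=> LM lphi x y; rewrite (le_trans (lphi x y))// ler_wpM2r ?enorm_ge0.
Qed.

End lipschitz_closure.

(* Lipschitz partition of unity subordinate to the balls of radius [2e] around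
   the first [K] points of a dense sequence; it sums to [ball_cover K], which
   increases to 1. *)
Section partition_of_unity.
Context {R : realType} {d : nat}.
Variable e : R.
Hypothesis e0 : 0 < e.

(** Equal to 1 within distance [e] of the point and to 0 beyond [2 * e]. *)
Definition ball_bump (k : nat) (x : d.-tuple R) : R :=
  Num.min 1 (Num.max 0 (2 - e^-1 * enorm (vsub x (ratpt d k)))).

Fixpoint ball_cover (K : nat) (x : d.-tuple R) : R :=
  if K is K'.+1 then Num.max (ball_cover K' x) (ball_bump K' x) else 0.

(** Increments of a running maximum telescope, without dividing by a sum of bumps, so that their
    Lipschitz constant does not depend on [k]. *)
Definition punity (k : nat) (x : d.-tuple R) : R := ball_cover k.+1 x - ball_cover k x.

Definition tail (K : nat) (x : d.-tuple R) : R := (1 - ball_cover K x) * enorm x.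

Lemma lipw_bump k : lipw e^-1 (ball_bump k).
Proof.
have ei0 : 0 <= e^-1 by rewrite invr_ge0 ltW.
apply: lipw_min; first exact: (lipwS ei0 (lipw_cst _)).
apply: lipw_max; first exact: (lipwS ei0 (lipw_cst _)).
move=> x y; rewrite (_ : _ - _ = e^-1 *
  (enorm (vsub y (ratpt d k)) - enorm (vsub x (ratpt d k)))); last by ring.
rewrite normrM ger0_norm// ler_wpM2l// (le_trans (ler_enorm_dist _ _))//.
rewrite (_ : vsub _ _ = vsub y x) 1?enorm_vsubC//.
by apply: eq_from_tnth => i; rewrite !tnth_mktuple opprB addrA subrK.
Qed.

Lemma lipw_cover K : lipw e^-1 (ball_cover K).
Proof.
elim: K => [|K ih]; last by apply: lipw_max => //; exact: lipw_bump.
by apply: lipwS (lipw_cst _); rewrite invr_ge0 ltW.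
Qed.

Lemma lipw_punity k : lipw (e^-1 + e^-1) (punity k).
Proof. by apply: lipwB; exact: lipw_cover. Qed.

Lemma bump_le1 k x : ball_bump k x <= 1.
Proof. by rewrite /ball_bump ge_min lexx. Qed.

Lemma cover_ge0 K x : 0 <= ball_cover K x.
Proof. by elim: K => //= K ih; rewrite le_max ih. Qed.

Lemma cover_le1 K x : ball_cover K x <= 1.
Proof. by elim: K => //= K ih; rewrite ge_max ih bump_le1. Qed.

Lemma punity_ge0 k x : 0 <= punity k x.
Proof. by rewrite subr_ge0/= le_max lexx. Qed.

Lemma punity_le1 k x : punity k x <= 1.
Proof. by rewrite lerBlDr (le_trans (cover_le1 _ _))// lerDl cover_ge0. Qed.

Lemma sum_punity K x : \sum_(k < K) punity k x = ball_cover K x.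
Proof.
elim: K => [|K ih]; first by rewrite big_ord0.
by rewrite big_ord_recr/= ih /punity addrC subrK.
Qed.

(** An increment is positive only where the new bump exceeds the previous maximum, hence is itself
    positive. The weighted form can be summed over [k] directly. *)
Lemma punity_supp k x : punity k x * enorm (vsub x (ratpt d k)) <= punity k x * (2 * e).
Proof.
have [h|/ltW h] := leP (enorm (vsub x (ratpt d k))) (2 * e).
  by rewrite ler_wpM2l// punity_ge0.
suff -> : punity k x = 0 by rewrite !mul0r.
rewrite /punity/= (max_idPl _) ?subrr//.
rewrite (le_trans _ (cover_ge0 _ _))// /ball_bump ge_min ge_max lexx/=.
by rewrite subr_le0 ler_pdivlMl// mulrC h orbT.
Qed.

Lemma cover_eq1 x : exists K0, forall K, (K0 <= K)%N -> ball_cover K x = 1.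
Proof.
have [k kx] := ratpt_dense x e0.
exists k.+1 => K kK; apply/eqP; rewrite eq_le cover_le1/=.
rewrite -(subnK kK); elim: (K - _)%N => [|n ih]; last by rewrite addSn/= le_max ih.
rewrite add0n/= le_max /ball_bump le_min lexx/= le_max; apply/orP; right; apply/orP; right.
have : e^-1 * enorm (vsub x (ratpt d k)) <= 1 by rewrite ler_pdivrMl// mulr1 ltW.
by move=> h; lra.
Qed.

Lemma tail_ge0 K x : 0 <= tail K x.
Proof. by rewrite mulr_ge0 ?enorm_ge0// subr_ge0 cover_le1. Qed.

Lemma tail_le K x : tail K x <= enorm x.
Proof. by rewrite -[leRHS]mul1r ler_wpM2r ?enorm_ge0// gerBl cover_ge0. Qed.

Lemma measurable_tail K : measurable_fun setT (tail K).
Proof.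
apply: measurable_funM; last exact: measurable_enorm.
by apply: measurable_funB => //; exact: measurable_lipw (lipw_cover _).
Qed.

(** Subtracting the value at the origin bounds the coefficients by [enorm (ratpt d k)], uniformly in
    [phi]. The error is the oscillation of [phi] over the balls, plus the uncovered weight times
    [phi x - phi 0]. *)
Lemma punity_approx K (phi : d.-tuple R -> R) x : lip1 phi ->
  `|phi x - phi (vzero R d) -
     \sum_(k < K) (phi (ratpt d k) - phi (vzero R d)) * punity k x|
  <= 2 * e + tail K x.
Proof.
move=> lphi; set p0 := phi (vzero R d).
have -> : phi x - p0 - \sum_(k < K) (phi (ratpt d k) - p0) * punity k x =
    \sum_(k < K) punity k x * (phi x - phi (ratpt d k)) + (1 - ball_cover K x) * (phi x - p0).
  rewrite -sum_punity mulrBl mul1r mulr_suml addrCA -sumrB; congr (_ + _).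
  rewrite -sumrN; apply: eq_bigr => i _; ring.
rewrite (le_trans (ler_normD _ _))// lerD//; last first.
  rewrite normrM ger0_norm ?subr_ge0 ?cover_le1// ler_wpM2l ?subr_ge0 ?cover_le1//.
  by rewrite (le_trans (lphi _ _))// vsubx0.
rewrite (le_trans (ler_norm_sum _ _ _))//.
apply: (@le_trans _ _ (\sum_(k < K) punity k x * (2 * e))).
  apply: ler_sum => k _; rewrite normrM ger0_norm ?punity_ge0//.
  rewrite (le_trans _ (punity_supp _ _))// ler_wpM2l ?punity_ge0//.
rewrite -mulr_suml sum_punity -[leRHS]mul1r ler_wpM2r ?cover_le1//.
by rewrite mulr_ge0// ltW.
Qed.

Variable mu : probability (d.-tuple R) R.
Hypothesis muP : inP1 mu.

Lemma integrable_enorm : mu.-integrable setT (EFin \o @enorm R d).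
Proof.
apply: (lipw_integrable muP (L := 1)) => x y; rewrite mul1r.
exact: ler_enorm_dist.
Qed.

Lemma integrable_tail K : mu.-integrable setT (EFin \o tail K).
Proof.
apply: le_integrable integrable_enorm => //.
  by apply/measurable_EFinP; exact: measurable_tail.
by move=> x _ /=; rewrite lee_fin !ger0_norm ?enorm_ge0 ?tail_ge0// tail_le.
Qed.

(** At each point the tails are eventually 0, and they are dominated by the norm, which is
    integrable as [mu] has a first moment. *)
Lemma Rintegral_tail_small eps : 0 < eps -> exists K, \int[mu]_x tail K x <= eps.
Proof.
move=> eps0.
have [] := @dominated_convergence _ _ _ mu setT measurableT
  (fun K x => (tail K x)%:E) (cst 0%E) (EFin \o @enorm R d).
- by move=> K; apply/measurable_EFinP; exact: measurable_tail.
- by [].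
- apply/aeW => x _; have [K0 h] := cover_eq1 x.
  apply: cvg_near_cst; exists K0 => // K /h hK.
  by rewrite /tail hK subrr mul0r.
- exact: integrable_enorm.
- apply/aeW => x K _; rewrite /= lee_fin ger0_norm ?tail_ge0//.
  exact: tail_le.
move=> _ _; rewrite integral0 => /fine_cvgP[_].
move=> /cvgrPdist_le/(_ _ eps0)[K _ /(_ K (leqnn K))].
rewrite /= sub0r normrN => h; exists K.
exact: le_trans (ler_norm _) h.
Qed.

(** The bound is free of [phi]: a supremum over all 1-Lipschitz functions becomes finitely many
    averages. The approximation error, [2 * e] plus a tail, is paid once for the average over [y]
    and once for [mu]. *)
Lemma W1_empirical_le N K (x y : nat -> d.-tuple R) : (0 < N)%N ->
  (W1 (empirical N x) mu <=
    (avg N (fun i => enorm (vsub (x i) (y i))) +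
     (4 * e + avg N (fun i => tail K (y i)) + \int[mu]_z tail K z +
     \sum_(k < K) enorm (ratpt d k : d.-tuple R) *
       `|avg N (fun i => punity k (y i)) - \int[mu]_z punity k z|))%:E)%E.
Proof.
move=> N0; apply: ge_ereal_sup => _ [phi lphi <-].
have lwphi := lip1_lipw lphi.
have iphi := lipw_integrable muP lwphi.
rewrite integral_empirical//; last exact: measurable_lipw lwphi.
have -> : (\int[mu]_z (phi z)%:E = (\int[mu]_z phi z)%:E)%E.
  by rewrite fineK//; exact: integrable_fin_num.
rewrite -EFinB abse_EFin lee_fin.
set p0 := phi (vzero R d).
pose c k := phi (ratpt d k) - p0.
pose g z := \sum_(k < K) c k * punity k z.
have ipun k : mu.-integrable setT (EFin \o punity k).
  exact: lipw_integrable (lipw_punity _).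
have icst (r : R) : mu.-integrable setT (EFin \o cst r).
  exact: finite_measure_integrable_cst.
have ig : mu.-integrable setT (EFin \o g).
  rewrite (_ : _ \o _ = fun z => (\sum_(k < K) (c k)%:E * (punity k z)%:E)%E).
    by apply: integrable_sum => // k _; exact: (integrableZl _ _ (ipun k)).
  apply/funext => z /=; rewrite /g -sumEFin; apply: eq_bigr => k _.
  by rewrite EFinM.
have gle : `|avg N (fun i => g (y i)) - \int[mu]_z g z| <=
     \sum_(k < K) enorm (ratpt d k : d.-tuple R) *
       `|avg N (fun i => punity k (y i)) - \int[mu]_z punity k z|.
  have -> : \int[mu]_z g z = \sum_(k < K) c k * \int[mu]_z punity k z.
    rewrite Rintegral_sum; last by move=> k; exact: (integrableZl _ _ (ipun k)).
    by apply: eq_bigr => k _; apply: RintegralZl => //; exact: ipun.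
  have -> : avg N (fun i => g (y i)) = \sum_(k < K) c k * avg N (fun i => punity k (y i)).
    by rewrite /avg exchange_big/= mulr_sumr; apply: eq_bigr => k _;
      rewrite -mulr_sumr mulrCA.
  rewrite -sumrB (le_trans (ler_norm_sum _ _ _))// ler_sum// => k _.
  rewrite -mulrBr normrM ler_wpM2r// (le_trans (lphi _ _))//.
  by rewrite vsubx0.
have Rcst (r : R) : \int[mu]_z r = r.
  by rewrite /Rintegral probability_integral_cst.
pose h z := phi z - p0 - g z.
have ih : mu.-integrable setT (EFin \o h).
  apply: (@integrableB _ _ _ mu setT measurableT (EFin \o (fun z => phi z - p0)) (EFin \o g)) => //.
  exact: (@integrableB _ _ _ mu setT measurableT (EFin \o phi) (EFin \o cst p0)).
have hle z : `|h z| <= 2 * e + tail K z by exact: punity_approx.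
have Rh : \int[mu]_z h z = \int[mu]_z phi z - p0 - \int[mu]_z g z.
  rewrite RintegralB//; last exact: (@integrableB _ _ _ mu setT measurableT (EFin \o phi) (EFin \o cst p0)).
  by rewrite RintegralB//; [rewrite Rcst|exact: icst].
have Ah : avg N (fun i => h (y i)) = avg N (fun i => phi (y i)) - p0 - avg N (fun i => g (y i)).
  by rewrite /h !avgB avg_cst.
have Ahle : `|avg N (fun i => h (y i))| <= 2 * e + avg N (fun i => tail K (y i)).
  rewrite (le_trans (ler_norm_avg _ _))// -[2 * e](avg_cst (2 * e) N0) -avgD.
  by apply: ler_avg => i _.
have Rhle : `|\int[mu]_z h z| <= 2 * e + \int[mu]_z tail K z.
  rewrite (le_trans (le_normr_Rintegral _ _))//.
  rewrite -[2 * e]Rcst -RintegralD//; [|exact: icst|exact: integrable_tail].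
  apply: le_Rintegral => //.
  - exact: integrable_norm.
  - exact: (@integrableD _ _ _ mu setT measurableT _ _ (icst _) (integrable_tail K)).
have xyle : `|avg N (fun i => phi (x i)) - avg N (fun i => phi (y i))| <=
    avg N (fun i => enorm (vsub (x i) (y i))).
  by rewrite -avgB (le_trans (ler_norm_avg _ _))//; apply: ler_avg => i _; exact: lphi.
move: Ahle Rhle xyle gle; rewrite Ah Rh.
set a1 := avg N (fun i => phi (x i)); set a2 := avg N (fun i => phi (y i)).
set a3 := avg N (fun i => g (y i)); set r1 := \int[mu]_z phi z.
set r2 := \int[mu]_z g z => h1 h2 h3 h4.
(* Passage from [x] to [y], then the approximation errors under the two measures, then the finite
   combination [g]. *)
rewrite (_ : a1 - r1 = a1 - a2 + ((a2 - p0 - a3) - (r1 - p0 - r2) + (a3 - r2))); last by ring.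
rewrite (le_trans (ler_normD _ _))// lerD// (le_trans (ler_normD _ _))// lerD//.
rewrite (le_trans (ler_normB _ _))// (le_trans (lerD h1 h2))//.
by lra.
Qed.

End partition_of_unity.

(** * Independence of the noise from the past *)

Lemma bigcap_preimageT I (T : Type) (U : I -> Type) (D : set I) (F : forall i, T -> U i) :
  \bigcap_(i in D) (F i @^-1` setT) = setT.
Proof. exact/seteqP. Qed.

Section fresh_noise.
Context {R : realType} {d m : nat} {dO : measure_display} {Omega : measurableType dO}.
Variables (P : probability Omega R) (theta : probability (m.-tuple R) R)
  (X0 : nat -> nat -> Omega -> d.-tuple R) (eps : nat -> nat -> Omega -> m.-tuple R).

Definition cylinders (J K : seq (nat * nat)) : set (set Omega) :=
  [set G | exists (B : nat * nat -> set (m.-tuple R)) (C : nat * nat -> set (d.-tuple R)),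
    [/\ (forall j, measurable (B j)), (forall k, measurable (C k)) &
    G = (\bigcap_(j in [set` J]) (eps j.1 j.2 @^-1` B j))
       `&` (\bigcap_(k in [set` K]) (X0 k.1 k.2 @^-1` C k))]].

(** The points of [Omega] with a coarser sigma-algebra: measurability on this type says that a map
    depends only on the noises in [J] and the initial values in [K]. *)
Definition past J K := g_sigma_algebraType (cylinders J K).

Lemma setI_closed_cylinders J K : setI_closed (cylinders J K).
Proof.
move=> _ _ [B [C [mB mC ->]]] [B' [C' [mB' mC' ->]]].
exists (fun j => B j `&` B' j), (fun k => C k `&` C' k); split.
- by move=> j; exact: measurableI.
- by move=> k; exact: measurableI.
- by rewrite setIACA -!bigcapI.
Qed.

Lemma cylindersT J K : cylinders J K setT.
Proof.
exists (fun=> setT), (fun=> setT); split => //.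
by rewrite !bigcap_preimageT setIT.
Qed.

Lemma measurable_noise_past J K j : j \in J ->
  measurable_fun [set: past J K] (eps j.1 j.2 : past J K -> _).
Proof.
move=> jJ _ B mB; rewrite setTI; apply: sub_sigma_algebra.
exists (fun i => if i == j then B else setT), (fun=> setT); split => //.
  by move=> i; case: ifP.
rewrite bigcap_preimageT setIT; apply/seteqP; split => [w Bw i iJ /=|w /(_ j jJ)/=].
  by case: eqP => // ->.
by rewrite eqxx.
Qed.

Lemma measurable_init_past J K k : k \in K ->
  measurable_fun [set: past J K] (X0 k.1 k.2 : past J K -> _).
Proof.
move=> kK _ C mC; rewrite setTI; apply: sub_sigma_algebra.
exists (fun=> setT), (fun i => if i == k then C else setT); split => //.
  by move=> i; case: ifP.
rewrite bigcap_preimageT setTI; apply/seteqP; split => [w Cw i iK /=|w /(_ k kK)/=].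
  by case: eqP => // ->.
by rewrite eqxx.
Qed.

Hypothesis mX0 : forall N i, (i < N)%N -> measurable_fun [set: Omega] (X0 N i).
Hypothesis meps : forall n i, measurable_fun [set: Omega] (eps n i).
Hypothesis indep : noise_iid_indep P theta X0 eps.

Variables J K : seq (nat * nat).
Hypothesis uJ : uniq J.
Hypothesis allK : all (fun k => (k.2 < k.1)%N) K.

Lemma cylinders_measurable : cylinders J K `<=` measurable.
Proof.
move=> _ [B [C [mB mC ->]]]; apply: measurableI.
  apply: fin_bigcap_measurable => [|j _]; first exact: finite_seq.
  by rewrite -[X in measurable X]setTI; exact: meps.
apply: fin_bigcap_measurable => [|k kK]; first exact: finite_seq.
by rewrite -[X in measurable X]setTI; apply: mX0 => //; exact: (allP allK).
Qed.

Definition to_past (w : Omega) : past J K := w.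

Lemma measurable_to_past : measurable_fun [set: Omega] to_past.
Proof.
move=> _ Y mY; rewrite setTI.
apply: (smallest_sub (@sigma_algebra_measurable _ Omega) cylinders_measurable).
exact: mY.
Qed.

Variable l : nat * nat.
Hypothesis lJ : l \notin J.

(** The product rule is used for [l :: J] and for [J]; freshness of [l] makes the longer list
    duplicate-free, and the two products differ by the factor [theta B]. *)
Lemma noise_past_cylinder G B : cylinders J K G -> measurable B ->
  P (G `&` eps l.1 l.2 @^-1` B) = (P G * theta B)%E.
Proof.
move=> [B' [C [mB' mC ->]]] mB.
have h : (\bigcap_(j in [set` l :: J])
    (eps j.1 j.2 @^-1` (if j == l then B else B' j))) =
    eps l.1 l.2 @^-1` B `&` \bigcap_(j in [set` J]) (eps j.1 j.2 @^-1` B' j).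
  apply/seteqP; split => [w Bw|w [Bw B'w] j/=].
    split; first by have := Bw l (mem_head _ _); rewrite eqxx.
    move=> j jJ; have := Bw j; rewrite /= inE (_ : j \in J)// orbT => /(_ isT).
    by case: eqP => // jl; move: lJ; rewrite -jl jJ.
  by rewrite inE; case: eqP => [->//|_ /=]; exact: B'w.
rewrite setIC setIA -h.
rewrite (indep (B := fun j => if j == l then B else B' j) (C := C)) //; last 2 first.
- by rewrite /= lJ.
- by move=> j; case: ifP.
rewrite (indep uJ allK mB' mC) big_cons eqxx [RHS]muleC muleA; congr (_ * _ * _)%E.
apply: eq_big_seq => j jJ.
by case: eqP => // jl; move: lJ; rewrite -jl jJ.
Qed.

Definition to_past_mfun : {mfun Omega >-> past J K} := mfun_Sub (mem_set measurable_to_past).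

Definition past_noise (w : Omega) : past J K * m.-tuple R := (to_past w, eps l.1 l.2 w).

Lemma measurable_past_noise : measurable_fun [set: Omega] past_noise.
Proof. by apply: measurable_fun_pair; [exact: measurable_to_past|exact: meps]. Qed.

Definition past_noise_mfun : {mfun Omega >-> (past J K * m.-tuple R)%type} :=
  mfun_Sub (mem_set measurable_past_noise).

(** For fixed [B] both sides are finite measures in [G] that agree on the pi-system of cylinders. *)
Lemma noise_past_indep G B : measurable (G : set (past J K)) -> measurable B ->
  P ((G : set Omega) `&` eps l.1 l.2 @^-1` B) = (P (G : set Omega) * theta B)%E.
Proof.
move=> mG mB.
have mE : measurable (eps l.1 l.2 @^-1` B).
  by rewrite -[X in measurable X]setTI; exact: meps.
have tB : theta B \is a fin_num by exact: fin_num_measure.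
have tB0 : 0 <= fine (theta B) by exact: fine_ge0.
pose m1 : {measure set (past J K) -> \bar R} :=
  pushforward (mrestr P mE) to_past.
pose m2 : {measure set (past J K) -> \bar R} :=
  mscale (NngNum tB0) (distribution P to_past_mfun).
have -> : (P (G : set Omega) * theta B)%E = m2 G.
  by rewrite /m2/= /mscale/= fineK// muleC.
rewrite -[LHS]/(m1 measurable_to_past G).
apply: (@measure_unique _ _ (past J K) (cylinders J K) (fun=> setT)) => //.
- exact: setI_closed_cylinders.
- by move=> _; exact: cylindersT.
- by rewrite bigcup_const//; exists 0%N.
- move=> A cA; rewrite /m1 /m2 /= /mscale/= fineK// muleC.
  exact: noise_past_cylinder.
- move=> _; rewrite /m1/= /pushforward/= /mrestr.
  apply: (@le_lt_trans _ _ 1%E); last exact: ltry.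
  by apply: probability_le1; rewrite preimage_setT setTI.
Qed.

(** The joint law of the past and the new noise is a product, so Tonelli integrates the noise first;
    this plays the part of conditioning on the past. *)
Lemma integral_fresh_noise_past (F : past J K * m.-tuple R -> \bar R) :
  measurable_fun setT F -> (forall p, 0 <= F p)%E ->
  (\int[P]_w F (to_past w, eps l.1 l.2 w) = \int[P]_w \int[theta]_z F (to_past w, z))%E.
Proof.
move=> mF F0.
rewrite -[LHS](ge0_integral_distribution (P := P) past_noise_mfun mF F0).
pose m1 : probability (past J K) R := distribution P to_past_mfun.
rewrite (eq_measure_integral (m1 \x theta)%E); last first.
  move=> A mA _; apply/esym; apply: product_measure_unique => // G B mG mB.
  exact: noise_past_indep.
rewrite fubini_tonelli1//.
rewrite ge0_integral_distribution//.
- exact: measurable_fun_fubini_tonelli_F.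
- by move=> w; exact: integral_ge0.
Qed.

End fresh_noise.

Section fresh_noise_integral.
Context {R : realType} {d m : nat} {dO : measure_display} {Omega : measurableType dO}.
Variables (P : probability Omega R) (theta : probability (m.-tuple R) R)
  (X0 : nat -> nat -> Omega -> d.-tuple R) (eps : nat -> nat -> Omega -> m.-tuple R).
Hypothesis mX0 : forall N i, (i < N)%N -> measurable_fun [set: Omega] (X0 N i).
Hypothesis meps : forall n i, measurable_fun [set: Omega] (eps n i).
Hypothesis indep : noise_iid_indep P theta X0 eps.

Lemma integral_fresh_noise J K l dV (V : measurableType dV) (v : Omega -> V)
    (H : V * m.-tuple R -> \bar R) :
  uniq J -> all (fun k => (k.2 < k.1)%N) K -> l \notin J ->
  measurable_fun [set: past X0 eps J K] (v : past X0 eps J K -> V) ->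
  measurable_fun setT H -> (forall p, 0 <= H p)%E ->
  (\int[P]_w H (v w, eps l.1 l.2 w) = \int[P]_w \int[theta]_z H (v w, z))%E.
Proof.
move=> uJ allK lJ mv mH H0.
apply: (integral_fresh_noise_past mX0 meps indep uJ allK lJ
  (F := fun p => H ((v : past X0 eps J K -> V) p.1, p.2))) => //.
apply: measurableT_comp => //; apply: measurable_fun_pair => //.
exact: measurableT_comp.
Qed.

End fresh_noise_integral.

(** * Measurability and adaptedness of both particle systems *)

Section particle_measurability.
Context {R : realType} {d m : nat} {dV : measure_display} {V : measurableType dV}.
Variables (A : 'M[R]_d) (delta : R)
  (f : d.-tuple R -> giry (d.-tuple R) R -> m.-tuple R -> d.-tuple R).
Hypothesis mf : measurable_fun [set: (d.-tuple R * giry (d.-tuple R) R) * m.-tuple R]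
    (fun p => f p.1.1 p.1.2 p.2).

Lemma measurable_empirical N (x : nat -> V -> d.-tuple R) : (0 < N)%N ->
  (forall i, (i < N)%N -> measurable_fun [set: V] (x i)) ->
  measurable_fun [set: V] (fun v => empirical N (fun i => x i v) : giry (d.-tuple R) R).
Proof.
move=> N0 mx; apply: measurable_giry_codensity => // B mB.
rewrite (_ : (fun v => _) = fun v => ((N%:R^-1)%:E *
    msum (fun i => @dirac _ (d.-tuple R) (x i v) R) N B)%E); last first.
  by apply/funext => v; exact: empiricalE.
apply: measurable_funeM; apply: emeasurable_sum => i.
exact: measurableT_comp (measurable_fun_dirac mB) (mx i (ltn_ord i)).
Qed.

Variables (X0 : nat -> nat -> V -> d.-tuple R) (eps : nat -> nat -> V -> m.-tuple R).

(** With [V] taken as [Omega] this is measurability, with [V] taken as [past] it is adaptedness;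
    hence the restriction to noises of times before [n]. *)
Lemma measurable_particles N n : (0 < N)%N ->
  (forall i, (i < N)%N -> measurable_fun [set: V] (X0 N i)) ->
  (forall k i, (k < n)%N -> (i < N)%N -> measurable_fun [set: V] (eps k i)) ->
  forall i, (i < N)%N -> measurable_fun [set: V] (particles A delta f X0 eps N n i).
Proof.
move=> N0 mX0; elim: n => [|n ih] meps i iN; first exact: mX0.
have {}ih : forall i, (i < N)%N ->
    measurable_fun [set: V] (particles A delta f X0 eps N n i).
  by apply: ih => k j kn jN; apply: meps => //; exact: ltnW.
apply: measurable_step; first exact: ih.
apply: (measurableT_comp mf (g := fun v => ((particles A delta f X0 eps N n i v,
  empirical N (fun j => particles A delta f X0 eps N n j v) : giry _ R), eps n i v))).
apply: measurable_fun_pair; last exact: meps.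
apply: measurable_fun_pair; first exact: ih.
exact: measurable_empirical.
Qed.

Variable mu : nat -> probability (d.-tuple R) R.

Fixpoint nlparticles (N n i : nat) (v : V) : d.-tuple R :=
  match n with
  | 0 => X0 N i v
  | n'.+1 => step A delta (nlparticles N n' i v)
      (f (nlparticles N n' i v) (mu n') (eps n' i v))
  end.

Lemma measurable_flow_step n :
  measurable_fun setT (fun p : d.-tuple R * m.-tuple R => step A delta p.1 (f p.1 (mu n) p.2)).
Proof.
apply: measurable_step => //.
apply: (measurableT_comp mf (g := fun p : d.-tuple R * m.-tuple R =>
  ((p.1, mu n : giry _ R), p.2))).
by apply: measurable_fun_pair => //; exact: measurable_fun_pair.
Qed.

Lemma measurable_nlparticles N n i :
  measurable_fun [set: V] (X0 N i) ->
  (forall k, (k < n)%N -> measurable_fun [set: V] (eps k i)) ->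
  measurable_fun [set: V] (nlparticles N n i).
Proof.
move=> mX0; elim: n => [|n ih] meps; first exact: mX0.
have {}ih : measurable_fun [set: V] (nlparticles N n i).
  by apply: ih => k kn; apply: meps; exact: ltnW.
apply: (measurableT_comp (measurable_flow_step n)
  (g := fun v => (nlparticles N n i v, eps n i v))).
by apply: measurable_fun_pair => //; exact: meps.
Qed.

End particle_measurability.

(** * The nonlinear flow and its first moments *)

Section flow.
Context {R : realType} {d m : nat}.
Variables (A : 'M[R]_d) (delta : R) (theta : probability (m.-tuple R) R)
  (f : d.-tuple R -> giry (d.-tuple R) R -> m.-tuple R -> d.-tuple R)
  (mu0 : probability (d.-tuple R) R) (mu : nat -> probability (d.-tuple R) R).
Hypothesis delta0 : 0 < delta.
Hypothesis mf : measurable_fun [set: (d.-tuple R * giry (d.-tuple R) R) * m.-tuple R]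
    (fun p => f p.1.1 p.1.2 p.2).
Hypothesis mu_flow : nonlinear_flow A delta f theta mu0 mu.

Lemma integral_flow n (h : d.-tuple R -> \bar R) :
  measurable_fun setT h -> (forall x, 0 <= h x)%E ->
  (\int[mu n.+1]_x h x =
   \int[mu n]_x \int[theta]_z h (step A delta x (f x (mu n) z)))%E.
Proof.
move=> mh h0.
have mPhi := measurable_flow_step A delta mf mu n.
set Phi := (fun p : _ * _ => _) in mPhi.
rewrite (eq_measure_integral (pushforward (mu n \x theta)%E Phi)); last first.
  by move=> B mB _; exact: mu_flow.2.
rewrite ge0_integral_pushforward//= fubini_tonelli1//.
exact: measurableT_comp.
Qed.

Hypothesis Df : (\int[theta]_z Dlip f z < +oo)%E.
Hypothesis f00 : (\int[theta]_z (enorm (f (vzero R d) (@dirac _ _ (vzero R d) R) z))%:E < +oo)%E.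
Hypothesis mu0P : inP1 mu0.

Let s := fine (maxe 0%E (\int[theta]_z Dlip f z)%E).

(** Comparing [f x (mu n) z] with the value at the origin and its Dirac mass gives a mean bound
    affine in [enorm x]: the difference is controlled by [s], the reference value by (A2). *)
Lemma flow_inP1 n : inP1 (mu n).
Proof.
elim: n => [|n ih]; first by rewrite mu_flow.1.
split; first exact: probability_setT.
rewrite integral_flow; last 2 first.
- by apply/measurable_EFinP; exact: measurable_enorm.
- by move=> x; rewrite lee_fin enorm_ge0.
have mM : (\int[mu n]_x (enorm x)%:E)%E \is a fin_num.
  by rewrite ge0_fin_numE; [case: ih|apply: integral_ge0 => x _; rewrite lee_fin enorm_ge0].
have c0fin : (\int[theta]_z (enorm (f (vzero R d) (@dirac _ _ (vzero R d) R) z))%:E)%E \is a fin_num.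
  by rewrite ge0_fin_numE//; apply: integral_ge0 => x _; rewrite lee_fin enorm_ge0.
set M := fine (\int[mu n]_x (enorm x)%:E)%E.
set c0 := fine (\int[theta]_z (enorm (f (vzero R d) (@dirac _ _ (vzero R d) R) z))%:E)%E.
have s0 : 0 <= s by exact: (Dlip_const_ge0 theta f).
have bound x : (\int[theta]_z (enorm (step A delta x (f x (mu n) z)))%:E <=
   ((mxbound A + delta * s) * enorm x + delta * (s * M + c0))%:E)%E.
  apply: (@le_trans _ _ (\int[theta]_z ((mxbound A * enorm x)%:E +
    delta%:E * ((enorm (vsub (f x (mu n) z) (f (vzero R d) (@dirac _ _ (vzero R d) R) z)))%:E
     + (enorm (f (vzero R d) (@dirac _ _ (vzero R d) R) z))%:E)))%E).
    apply: le_lower_integral => z; first by rewrite lee_fin enorm_ge0.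
    rewrite -EFinD lee_fin (le_trans (enorm_step _ _ _ (ltW delta0)))//.
    rewrite lerD2l ler_wpM2l// ?(ltW delta0)//.
    have := enorm_vsub_trans (f (vzero R d) (@dirac _ _ (vzero R d) R) z) (f x (mu n) z) (vzero R d).
    by rewrite !vsubx0.
  have m1 := measurable_kernel_dist mf x (mu n) (vzero R d) (@dirac _ _ (vzero R d) R).
  have m2 : measurable_fun setT
      (fun z => (enorm (f (vzero R d) (@dirac _ _ (vzero R d) R) z))%:E).
    apply/measurable_EFinP; apply: (measurableT_comp (@measurable_enorm R d)).
    exact: measurable_kernel_section.
  rewrite ge0_integralD//; last 3 first.
  - by move=> z _; rewrite lee_fin mulr_ge0 ?mxbound_ge0 ?enorm_ge0.
  - by move=> z _; rewrite mule_ge0 ?lee_fin ?(ltW delta0)// ?addr_ge0 ?enorm_ge0.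
  - by apply: measurable_funeM; exact: emeasurable_funD.
  rewrite ge0_integralZl_EFin//; last 3 first.
  - by move=> z _; rewrite -EFinD lee_fin addr_ge0 ?enorm_ge0.
  - exact: emeasurable_funD.
  - exact: ltW.
  rewrite ge0_integralD//; last 2 first.
  - by move=> z _; rewrite lee_fin enorm_ge0.
  - by move=> z _; rewrite lee_fin enorm_ge0.
  rewrite probability_integral_cst -[X in (_ + _ * (_ + X))%E](fineK c0fin) -/c0.
  have k := kernel_dist_le mf Df x (vzero R d) ih (inP1_dirac (vzero R d)) (r := M).
  rewrite vsubx0 in k.
  apply: (@le_trans _ _ ((mxbound A * enorm x)%:E + delta%:E * ((s * (enorm x + M))%:E + c0%:E))%E).
    rewrite leeD2l// lee_wpmul2l ?lee_fin ?(ltW delta0)// leeD2r//; apply: k.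
    by rewrite fineK//; exact: W1_dirac0.
  rewrite -EFinD lee_fin le_eqVlt; apply/orP; left; apply/eqP; ring.
apply: (@le_lt_trans _ _ (\int[mu n]_x ((mxbound A + delta * s) * enorm x + delta * (s * M + c0))%:E)%E).
  apply: le_lower_integral => // x; apply: integral_ge0 => z _; by rewrite lee_fin enorm_ge0.
under eq_integral do rewrite EFinD EFinM.
have M0 : 0 <= M by rewrite fine_ge0//; apply: integral_ge0 => x _; rewrite lee_fin enorm_ge0.
have c00 : 0 <= c0 by rewrite fine_ge0//; apply: integral_ge0 => x _; rewrite lee_fin enorm_ge0.
have CA0 : 0 <= mxbound A + delta * s.
  by rewrite addr_ge0 ?mxbound_ge0// mulr_ge0// ltW.
rewrite ge0_integralD//; last 3 first.
- by move=> x _; rewrite -EFinM lee_fin mulr_ge0 ?enorm_ge0.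
- by apply: measurable_funeM; apply/measurable_EFinP; exact: measurable_enorm.
- by move=> x _; rewrite lee_fin mulr_ge0 ?(ltW delta0)// addr_ge0// mulr_ge0.
rewrite ge0_integralZl_EFin//; last 2 first.
- by move=> x _; rewrite lee_fin enorm_ge0.
- by apply/measurable_EFinP; exact: measurable_enorm.
rewrite probability_integral_cst -(fineK mM) -EFinM -EFinD.
exact: ltry.
Qed.

End flow.

(** * The particles driven by the nonlinear flow *)

(** Off-diagonal terms vanish and the [N] diagonal ones are at most 1, so the mean square is at most
    [1 / N]; then [|a| <= a^2 / eta + eta] yields the first moment, with [eta] left free. *)
Lemma ler_integral_avg_decorrelated dT (T : measurableType dT) (R : realType)
    (P : probability T R) (N : nat) (Z : nat -> T -> R) (eta : R) :
  (0 < N)%N -> 0 < eta ->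
  (forall i, (i < N)%N -> measurable_fun setT (Z i)) ->
  (forall i x, (i < N)%N -> `|Z i x| <= 1) ->
  (forall i j, (i < N)%N -> (j < N)%N -> i != j -> \int[P]_x (Z i x * Z j x) = 0) ->
  (\int[P]_x `|avg N (Z ^~ x)|%:E <= (N%:R^-1 / eta + eta)%:E)%E.
Proof.
move=> N0 eta0 mZ Z1 Zij.
have NR0 : 0 < N%:R :> R by rewrite ltr0n.
have mavg : measurable_fun setT (fun x => avg N (Z ^~ x)).
  by apply: measurable_funM => //; apply: measurable_sum => i; exact: mZ.
have avg1 x : `|avg N (Z ^~ x)| <= 1.
  rewrite (le_trans (ler_norm_avg _ _))// -[leRHS](avg_cst 1 N0).
  by apply: ler_avg => i iN; exact: Z1.
have msq : measurable_fun setT (fun x => avg N (Z ^~ x) ^+ 2) by exact: measurable_funX.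
have isq : P.-integrable setT (EFin \o (fun x => avg N (Z ^~ x) ^+ 2)).
  by apply: (@bounded_integrable _ _ _ P _ 1) => // x; rewrite normrX exprn_ile1.
have iZZ (p : 'I_N * 'I_N) : P.-integrable setT (EFin \o (fun x => Z p.1 x * Z p.2 x)).
  apply: (@bounded_integrable _ _ _ P _ 1).
    by apply: measurable_funM; exact: mZ.
  by move=> x; rewrite normrM mulr_ile1// Z1.
have Esq : \int[P]_x (avg N (Z ^~ x) ^+ 2) <= N%:R^-1.
  have -> : \int[P]_x (avg N (Z ^~ x) ^+ 2) =
      \int[P]_x (N%:R^-2 * \sum_(p : 'I_N * 'I_N) Z p.1 x * Z p.2 x).
    apply: eq_Rintegral => x _; rewrite /avg exprMn exprVn; congr (_ * _).
    by rewrite expr2 mulr_suml; under eq_bigr do rewrite mulr_sumr; rewrite pair_bigA.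
  rewrite RintegralZl//; last first.
    apply: (@bounded_integrable _ _ _ P _ (\sum_(p : 'I_N * 'I_N) 1)).
      by apply: measurable_sum => p; apply: measurable_funM; exact: mZ.
    move=> x; rewrite (le_trans (ler_norm_sum _ _ _))// ler_sum// => p _.
    by rewrite normrM mulr_ile1// Z1.
  rewrite Rintegral_sum//.
  rewrite -(pair_bigA _ (fun i j : 'I_N => \int[P]_x (Z i x * Z j x)))/=.
  apply: (@le_trans _ _ (N%:R^-2 * \sum_(i < N) 1)).
    rewrite ler_wpM2l ?invr_ge0 ?exprn_ge0// ler_sum// => i _.
    rewrite (bigD1 i)//= big1 ?addr0; last first.
      by move=> j ji; apply: Zij => //; rewrite eq_sym.
    have -> : 1 = \int[P]_x (1 : R).
      by rewrite /Rintegral probability_integral_cst.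
    apply: le_Rintegral => //; first exact: (iZZ (i, i)).
    - exact: (finite_measure_integrable_cst P 1).
    - by move=> x _; rewrite (le_trans (ler_norm _))// normrM mulr_ile1// Z1.
  rewrite sumr_const card_ord expr2 invfM -[1 *+ N]/N%:R -mulrA mulVf ?mulr1//.
  by rewrite gt_eqF.
have aeta x : `|avg N (Z ^~ x)| <= eta^-1 * avg N (Z ^~ x) ^+ 2 + eta.
  rewrite -real_normK ?num_real//; set a := `|_|.
  have a0 : 0 <= a by exact: normr_ge0.
  have [ae|/ltW ea] := leP a eta.
    by rewrite (le_trans ae)// lerDr mulr_ge0 ?exprn_ge0// invr_ge0 ltW.
  apply: (@le_trans _ _ (eta^-1 * a ^+ 2)); last by rewrite lerDl ltW.
  by rewrite ler_pdivlMl// expr2 ler_wpM2r.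
apply: (@le_trans _ _ (\int[P]_x ((eta^-1 * avg N (Z ^~ x) ^+ 2)%:E + eta%:E))%E).
  by apply: le_lower_integral => x; rewrite ?lee_fin// -EFinD lee_fin.
rewrite ge0_integralD//; last 3 first.
- by move=> x _; rewrite lee_fin mulr_ge0 ?sqr_ge0// invr_ge0 ltW.
- by apply/measurable_EFinP; exact: measurable_funM.
- by move=> x _; rewrite lee_fin ltW.
under eq_integral do rewrite EFinM.
rewrite integralZl//.
rewrite probability_integral_cst -[X in (_ * X)%E]fineK; last exact: integrable_fin_num isq.
by rewrite -EFinM -EFinD lee_fin lerD2r mulrC ler_wpM2r ?invr_ge0 ?(ltW eta0).
Qed.

Section nonlinear_particles.
Context {R : realType} {d m : nat} (A : 'M[R]_d) (delta : R)
  (theta : probability (m.-tuple R) R)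
  (f : d.-tuple R -> giry (d.-tuple R) R -> m.-tuple R -> d.-tuple R)
  {dO : measure_display} {Omega : measurableType dO} (P : probability Omega R)
  (mu0 : probability (d.-tuple R) R)
  (X0 : nat -> nat -> Omega -> d.-tuple R) (eps : nat -> nat -> Omega -> m.-tuple R)
  (mu : nat -> probability (d.-tuple R) R).
Hypothesis delta0 : 0 < delta.
Hypothesis mf : measurable_fun [set: (d.-tuple R * giry (d.-tuple R) R) * m.-tuple R]
    (fun p => f p.1.1 p.1.2 p.2).
Hypothesis Df : (\int[theta]_z Dlip f z < +oo)%E.
Hypothesis f00 : (\int[theta]_z (enorm (f (vzero R d) (@dirac _ _ (vzero R d) R) z))%:E < +oo)%E.
Hypothesis mu0P : inP1 mu0.
Hypothesis mX0 : forall N i, (i < N)%N -> measurable_fun [set: Omega] (X0 N i).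
Hypothesis X0law : forall N i, (i < N)%N -> forall B, measurable B ->
  P (X0 N i @^-1` B) = mu0 B.
Hypothesis meps : forall n i, measurable_fun [set: Omega] (eps n i).
Hypothesis indep : noise_iid_indep P theta X0 eps.
Hypothesis mu_flow : nonlinear_flow A delta f theta mu0 mu.

Let s := fine (maxe 0%E (\int[theta]_z Dlip f z)%E).
Let Y := nlparticles A delta f X0 eps mu.

(** [eps n i] drives the step from [n] to [n.+1]: the state at time [n] sees only indices strictly
    below [n], and [(n, i)] is fresh. *)
Definition noise_before (n N : nat) : seq (nat * nat) :=
  [seq (k, i) | k <- iota 0 n, i <- iota 0 N].

Definition init_indices (N : nat) : seq (nat * nat) := [seq (N, i) | i <- iota 0 N].

Lemma mem_noise_before n N k i : ((k, i) \in noise_before n N) = (k < n)%N && (i < N)%N.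
Proof.
apply/allpairsP/andP => [[[a b]/=]|[kn iN]].
  by rewrite !mem_iota !add0n => -[an bN [-> ->]].
by exists (k, i); rewrite !mem_iota !add0n.
Qed.

Lemma uniq_noise_before n N : uniq (noise_before n N).
Proof.
by apply: allpairs_uniq; [exact: iota_uniq|exact: iota_uniq|move=> [a b] [a' b'] _ _ []/= -> ->].
Qed.

Lemma all_init_indices N : all (fun k => (k.2 < k.1)%N) (init_indices N).
Proof. by apply/allP => _ /mapP[i + ->]; rewrite mem_iota add0n. Qed.

Lemma mem_init_indices N i : (i < N)%N -> (N, i) \in init_indices N.
Proof. by move=> iN; apply/mapP; exists i => //; rewrite mem_iota add0n. Qed.

Lemma measurable_nlparticles_past J N n i : (i < N)%N ->
  {subset noise_before n N <= J} ->
  measurable_fun [set: past X0 eps J (init_indices N)]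
    (Y N n i : past X0 eps J (init_indices N) -> _).
Proof.
move=> iN JN; apply: (@measurable_nlparticles _ _ _ _ (past X0 eps J (init_indices N))) => //.
  exact: (@measurable_init_past _ _ _ _ _ X0 eps J _ (N, i) (mem_init_indices iN)).
move=> k kn; apply: (@measurable_noise_past _ _ _ _ _ X0 eps J _ (k, i)).
by apply: JN; rewrite mem_noise_before kn.
Qed.

Lemma measurable_nlparticles_Omega N n i : (i < N)%N ->
  measurable_fun [set: Omega] (Y N n i).
Proof. by move=> iN; apply: measurable_nlparticles => //; exact: mX0. Qed.

(** The induction is over all [h]: integrating out the last noise replaces [h] by its one-step mean,
    on the side of the particle and on that of the flow alike. *)
Lemma nlparticles_law N n i (h : d.-tuple R -> \bar R) : (i < N)%N ->
  measurable_fun setT h -> (forall x, 0 <= h x)%E ->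
  (\int[P]_w h (Y N n i w) = \int[mu n]_x h x)%E.
Proof.
move=> iN; elim: n h => [|n ih] h mh h0.
  pose nu : {measure set (d.-tuple R) -> \bar R} := pushforward P (X0 N i).
  rewrite mu_flow.1 [RHS](eq_measure_integral (nu (mX0 iN))).
    by rewrite ge0_integral_pushforward//; exact: mX0.
  by move=> B mB _; apply/esym; exact: X0law.
have mPhi := measurable_flow_step A delta mf mu n.
pose H (p : d.-tuple R * m.-tuple R) := h (step A delta p.1 (f p.1 (mu n) p.2)).
have mH : measurable_fun setT H by exact: measurableT_comp mh mPhi.
transitivity (\int[P]_w \int[theta]_z H (Y N n i w, z))%E.
  apply: (@integral_fresh_noise _ _ _ _ _ P theta X0 eps mX0 meps indep
    (noise_before n N) (init_indices N) (n, i)) => //.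
  - exact: uniq_noise_before.
  - exact: all_init_indices.
  - by rewrite mem_noise_before ltnn.
  - exact: measurable_nlparticles_past.
  - by move=> p; rewrite /H h0.
rewrite (integral_flow mf mu_flow)//.
apply: (ih (fun x => \int[theta]_z H (x, z))%E).
- by apply: (@measurable_fun_fubini_tonelli_F _ _ _ _ _ theta H) => // p; rewrite /H h0.
- by move=> x; apply: integral_ge0 => z _; rewrite /H h0.
Qed.

Let s0 : 0 <= s. Proof. exact: (Dlip_const_ge0 theta f). Qed.

(** The transition operator, at time [n], of the Markov chain followed by each particle of the
    nonlinear system. *)
Definition flow_mean n (phi : d.-tuple R -> R) (x : d.-tuple R) : R :=
  \int[theta]_z phi (step A delta x (f x (mu n) z)).

Section observable.
Variables (n : nat) (phi : d.-tuple R -> R) (L : R).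
Hypothesis L0 : 0 <= L.
Hypothesis lphi : lipw L phi.
Hypothesis phi01 : forall x, 0 <= phi x <= 1.

Let muP : inP1 (mu n). Proof. exact: (flow_inP1 delta0 mf mu_flow). Qed.

Let mphi : measurable_fun setT phi. Proof. exact: measurable_lipw lphi. Qed.

Let H (p : d.-tuple R * m.-tuple R) := phi (step A delta p.1 (f p.1 (mu n) p.2)).

Let mH : measurable_fun setT H.
Proof. exact: measurableT_comp mphi (measurable_flow_step A delta mf mu n). Qed.

Let H1 p : `|H p| <= 1.
Proof. by have /andP[p0 p1] := phi01 (step A delta p.1 (f p.1 (mu n) p.2)); rewrite ger0_norm. Qed.

Let iH x : theta.-integrable setT (EFin \o (fun z => H (x, z))).
Proof.
apply: (@bounded_integrable _ _ _ theta _ 1) => //.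
exact: measurableT_comp mH (measurable_pair1 x).
Qed.

Lemma flow_meanE x : (\int[theta]_z (H (x, z))%:E = (flow_mean n phi x)%:E)%E.
Proof. by rewrite fineK//; apply: integrable_fin_num => //; exact: iH. Qed.

Lemma flow_mean01 x : 0 <= flow_mean n phi x <= 1.
Proof.
apply/andP; split; rewrite -lee_fin -flow_meanE.
  by apply: integral_ge0 => z _; rewrite lee_fin; case/andP: (phi01 (step A delta x (f x (mu n) z))).
rewrite -(probability_integral_cst theta 1); apply: le_lower_integral => z.
  by rewrite lee_fin; case/andP: (phi01 (step A delta x (f x (mu n) z))).
by rewrite lee_fin; case/andP: (phi01 (step A delta x (f x (mu n) z))).
Qed.

(** This closes the class of observables under one step back in time. Both arguments feel the same
    [mu n], so the Wasserstein term is 0 and only the averaged constant [s] remains. *)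
Lemma lipw_flow_mean : lipw (L * (mxbound A + delta * s)) (flow_mean n phi).
Proof.
move=> x y; rewrite -RintegralB//; [|exact: iH|exact: iH].
rewrite (le_trans (le_normr_Rintegral _ _))//.
  by apply: (@integrableB _ _ _ theta setT measurableT (EFin \o (fun z => H (x, z)))
    (EFin \o (fun z => H (y, z)))) => //; exact: iH.
rewrite -lee_fin fineK; last first.
  apply: integrable_fin_num => //; apply: integrable_norm.
  by apply: (@integrableB _ _ _ theta setT measurableT (EFin \o (fun z => H (x, z)))
    (EFin \o (fun z => H (y, z)))) => //; exact: iH.
apply: (@le_trans _ _ (\int[theta]_z ((L * (mxbound A * enorm (vsub x y)))%:E +
   (L * delta)%:E * (enorm (vsub (f x (mu n) z) (f y (mu n) z)))%:E))%E).
  apply: le_lower_integral => z; first by rewrite lee_fin.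
  rewrite -EFinM -EFinD lee_fin (le_trans (lphi _ _))//.
  by rewrite -mulrA -mulrDr ler_wpM2l// enorm_step_vsub// ltW.
have mk := measurable_kernel_dist mf x (mu n) y (mu n).
rewrite ge0_integralD//; last 3 first.
- by move=> z _; rewrite lee_fin !mulr_ge0 ?mxbound_ge0 ?enorm_ge0.
- by move=> z _; rewrite -EFinM lee_fin !mulr_ge0 ?enorm_ge0 ?(ltW delta0).
- exact: measurable_funeM.
rewrite ge0_integralZl_EFin//; last 2 first.
- by move=> z _; rewrite lee_fin enorm_ge0.
- by rewrite mulr_ge0 ?(ltW delta0).
rewrite probability_integral_cst.
have k := kernel_dist_le mf Df x y muP muP (W1xx muP).
apply: (@le_trans _ _ ((L * (mxbound A * enorm (vsub x y)))%:E +
   (L * delta)%:E * (s * (enorm (vsub x y) + 0))%:E)%E).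
  by rewrite leeD2l// lee_wpmul2l// lee_fin mulr_ge0// ltW.
rewrite -EFinM -EFinD lee_fin addr0 le_eqVlt; apply/orP; left; apply/eqP; rewrite -/s; ring.
Qed.

Let mg : measurable_fun setT (flow_mean n phi).
Proof. exact: measurable_lipw lipw_flow_mean. Qed.

Lemma Rintegral_flow : \int[mu n.+1]_x phi x = \int[mu n]_x flow_mean n phi x.
Proof.
rewrite /Rintegral (integral_flow mf mu_flow); last 2 first.
- exact/measurable_EFinP.
- by move=> x; rewrite lee_fin; case/andP: (phi01 x).
by congr fine; apply: eq_integral => x _; exact: flow_meanE.
Qed.

Variable N : nat.

(** The past is enlarged by the noise [(n, i)], so that [W] may depend on particle [i] at time
    [n.+1]; as [i != j], the noise [(n, j)] is still fresh and can be integrated out. *)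
Lemma flow_mean_decorrelation i j (W : Omega -> R) : (j < N)%N -> i != j ->
  measurable_fun [set: past X0 eps ((n, i) :: noise_before n N) (init_indices N)]
    (W : past X0 eps ((n, i) :: noise_before n N) (init_indices N) -> R) ->
  (forall w, 0 <= W w) ->
  \int[P]_w (W w * phi (Y N n.+1 j w)) = \int[P]_w (W w * flow_mean n phi (Y N n j w)).
Proof.
move=> jN ij mW W0; congr fine.
(* The absolute value makes the integrand nonnegative on the whole product space; along [W] it
   changes nothing. *)
pose HH (p : (R * d.-tuple R) * m.-tuple R) := (`|p.1.1| * H (p.1.2, p.2))%:E.
transitivity (\int[P]_w HH ((W w, Y N n j w), eps n j w))%E.
  by apply: eq_integral => w _; rewrite /HH/= ger0_norm.
have HH0 p : (0 <= HH p)%E.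
  rewrite lee_fin mulr_ge0//.
  by case/andP: (phi01 (step A delta p.1.2 (f p.1.2 (mu n) p.2))).
rewrite (@integral_fresh_noise _ _ _ _ _ P theta X0 eps mX0 meps indep
    ((n, i) :: noise_before n N) (init_indices N) (n, j) _ _
    (fun w => (W w, Y N n j w)) HH) => //.
- apply: eq_integral => w _; rewrite /HH/= (ger0_norm (W0 w)).
  under eq_integral do rewrite EFinM.
  rewrite integralZl//; last exact: iH.
  by rewrite flow_meanE -EFinM.
- by rewrite /= uniq_noise_before mem_noise_before ltnn.
- exact: all_init_indices.
- by rewrite inE mem_noise_before ltnn orbF xpair_eqE eqxx/= eq_sym.
- apply: measurable_fun_pair => //; apply: measurable_nlparticles_past => // k kJ.
  by rewrite inE kJ orbT.
- apply/measurable_EFinP; apply: measurable_funM.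
    apply: measurableT_comp => //; exact: measurableT_comp.
  apply: (measurableT_comp mH (g := fun p : (R * d.-tuple R) * m.-tuple R => (p.1.2, p.2))).
  by apply: measurable_fun_pair => //; exact: measurableT_comp.
Qed.

Lemma fluctuation_le eta : (0 < N)%N -> 0 < eta ->
  (\int[P]_w `|avg N (fun i => phi (Y N n.+1 i w)) -
     avg N (fun i => flow_mean n phi (Y N n i w))|%:E <= (N%:R^-1 / eta + eta)%:E)%E.
Proof.
move=> N0 eta0.
pose Z i w := phi (Y N n.+1 i w) - flow_mean n phi (Y N n i w).
have mphiY i : (i < N)%N -> measurable_fun setT (fun w => phi (Y N n.+1 i w)).
  by move=> iN; apply: (measurableT_comp mphi); exact: measurable_nlparticles_Omega.
have mgY i : (i < N)%N -> measurable_fun setT (fun w => flow_mean n phi (Y N n i w)).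
  by move=> iN; apply: (measurableT_comp mg); exact: measurable_nlparticles_Omega.
under eq_integral do rewrite -avgB.
apply: (ler_integral_avg_decorrelated (Z := Z)) => //.
- by move=> i iN; apply: measurable_funB; [exact: mphiY|exact: mgY].
- move=> i w _; rewrite /Z ler_norml.
  have /andP[? ?] := phi01 (Y N n.+1 i w).
  have /andP[? ?] := flow_mean01 (Y N n i w).
  by apply/andP; split; lra.
move=> i j iN jN ij.
pose a := fun w => phi (Y N n.+1 i w); pose b := fun w => flow_mean n phi (Y N n i w).
pose a' := fun w => phi (Y N n.+1 j w); pose b' := fun w => flow_mean n phi (Y N n j w).
have bd (u v : Omega -> R) : measurable_fun setT u -> measurable_fun setT v ->
    (forall w, 0 <= u w <= 1) -> (forall w, 0 <= v w <= 1) ->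
    P.-integrable setT (EFin \o (fun w => u w * v w)).
  move=> mu' mv u1 v1; apply: (@bounded_integrable _ _ _ P _ 1).
    exact: measurable_funM.
  move=> w; have /andP[u0 ?] := u1 w; have /andP[v0 ?] := v1 w.
  by rewrite ger0_norm ?mulr_ge0// mulr_ile1.
have a01 w : 0 <= a w <= 1 by exact: phi01.
have a'01 w : 0 <= a' w <= 1 by exact: phi01.
have b01 w : 0 <= b w <= 1 by exact: flow_mean01.
have b'01 w : 0 <= b' w <= 1 by exact: flow_mean01.
have iaa' := bd a a' (mphiY _ iN) (mphiY _ jN) a01 a'01.
have iab' := bd a b' (mphiY _ iN) (mgY _ jN) a01 b'01.
have iba' := bd b a' (mgY _ iN) (mphiY _ jN) b01 a'01.
have ibb' := bd b b' (mgY _ iN) (mgY _ jN) b01 b'01.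
(* [Z i] is signed whereas the decorrelation takes a nonnegative weight: the product is split as
   [a (a' - b') - b (a' - b')], each half having mean 0. *)
have -> : \int[P]_x (Z i x * Z j x) =
    \int[P]_x ((a x * a' x - a x * b' x) - (b x * a' x - b x * b' x)).
  by apply: eq_Rintegral => w _; rewrite /Z -/(a w) -/(b w) -/(a' w) -/(b' w); ring.
rewrite RintegralB//; last 2 first.
- exact: (integrableB measurableT iaa' iab').
- exact: (integrableB measurableT iba' ibb').
rewrite RintegralB// RintegralB//.
have mYp : measurable_fun [set: past X0 eps ((n, i) :: noise_before n N) (init_indices N)]
    (Y N n i : past X0 eps ((n, i) :: noise_before n N) (init_indices N) -> _).
  by apply: measurable_nlparticles_past => // k kJ; rewrite inE kJ orbT.
rewrite (flow_mean_decorrelation jN ij (W := a)); last 2 first.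
- apply: (measurableT_comp mH (g := fun w : past X0 eps ((n, i) :: noise_before n N) (init_indices N) =>
    (Y N n i w, eps n i w))).
  apply: measurable_fun_pair => //.
  by apply: (@measurable_noise_past _ _ _ _ _ X0 eps _ _ (n, i)); rewrite mem_head.
- by move=> w; case/andP: (a01 w).
rewrite (flow_mean_decorrelation jN ij (W := b)); last 2 first.
- exact: (measurableT_comp mg mYp).
- by move=> w; case/andP: (b01 w).
by rewrite !subrr.
Qed.

End observable.

End nonlinear_particles.

(** * Convergence *)

Lemma cvge0P (R : realType) (u : nat -> \bar R) : (forall n, 0 <= u n)%E ->
  u @ \oo --> 0%E <->
  forall e : R, 0 < e -> exists N0, forall N, (N0 <= N)%N -> (u N <= e%:E)%E.
Proof.
move=> u0; split => [/fine_cvgP[[N1 _ fu] /cvgrPdist_le cu] e e0|h].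
  have [N2 _ h] := cu _ e0.
  exists (maxn N1 N2) => N; rewrite geq_max => /andP[N1N N2N].
  rewrite -(fineK (fu N N1N)) lee_fin (le_trans (ler_norm _))//.
  by have := h N N2N; rewrite /= sub0r normrN.
apply/fine_cvgP; split.
  have [N0 h0] := h 1 ltr01; exists N0 => // N /= N0N.
  by rewrite ge0_fin_numE// (le_lt_trans (h0 N N0N)) ?ltry.
apply/cvgrPdist_le => e e0; have [N0 h0] := h e e0; exists N0 => // N /= N0N.
have hN := h0 N N0N.
have fN : u N \is a fin_num by rewrite ge0_fin_numE// (le_lt_trans hN) ?ltry.
by rewrite sub0r normrN ger0_norm ?fine_ge0// -lee_fin fineK.
Qed.

Section integral_avg.
Context dT (T : measurableType dT) (R : realType) (P : probability T R).

Lemma measurable_avg N (h : nat -> T -> R) :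
  (forall i, (i < N)%N -> measurable_fun setT (h i)) ->
  measurable_fun setT (fun x => avg N (h ^~ x)).
Proof.
move=> mh; apply: measurable_funM => //.
by apply: measurable_sum => i; exact: mh.
Qed.

Lemma ge0_integral_avg N (h : nat -> T -> R) :
  (forall i, (i < N)%N -> measurable_fun setT (h i)) -> (forall i x, 0 <= h i x) ->
  (\int[P]_x (avg N (h ^~ x))%:E =
   (N%:R^-1)%:E * \sum_(i < N) \int[P]_x (h i x)%:E)%E.
Proof.
move=> mh h0; rewrite /avg; under eq_integral do rewrite EFinM.
rewrite ge0_integralZl_EFin//; last 2 first.
- by move=> x _; rewrite lee_fin sumr_ge0.
- by apply/measurable_EFinP; apply: measurable_sum => i; exact: mh.
congr (_ * _)%E; under eq_integral do rewrite -sumEFin.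
rewrite ge0_integral_sum// => [i|i x _]; last by rewrite lee_fin.
by apply/measurable_EFinP; exact: mh.
Qed.

Lemma ge0_le_integral_avg N (h k : nat -> T -> R) :
  (forall i, (i < N)%N -> measurable_fun setT (h i)) -> (forall i x, 0 <= h i x) ->
  (forall i, (i < N)%N -> measurable_fun setT (k i)) -> (forall i x, 0 <= k i x) ->
  (forall i, (i < N)%N -> (\int[P]_x (h i x)%:E <= \int[P]_x (k i x)%:E)%E) ->
  (\int[P]_x (avg N (h ^~ x))%:E <= \int[P]_x (avg N (k ^~ x))%:E)%E.
Proof.
move=> mh h0 mk k0 hk; rewrite !ge0_integral_avg//.
by rewrite lee_wpmul2l ?lee_fin ?invr_ge0// lee_sum// => i _; exact: hk.
Qed.

End integral_avg.

Section convergence.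
Context {R : realType} {d m : nat} (A : 'M[R]_d) (delta : R)
  (theta : probability (m.-tuple R) R)
  (f : d.-tuple R -> giry (d.-tuple R) R -> m.-tuple R -> d.-tuple R)
  {dO : measure_display} {Omega : measurableType dO} (P : probability Omega R)
  (mu0 : probability (d.-tuple R) R)
  (X0 : nat -> nat -> Omega -> d.-tuple R) (eps : nat -> nat -> Omega -> m.-tuple R)
  (mu : nat -> probability (d.-tuple R) R).
Hypothesis delta0 : 0 < delta.
Hypothesis mf : measurable_fun [set: (d.-tuple R * giry (d.-tuple R) R) * m.-tuple R]
    (fun p => f p.1.1 p.1.2 p.2).
Hypothesis Df : (\int[theta]_z Dlip f z < +oo)%E.
Hypothesis f00 : (\int[theta]_z (enorm (f (vzero R d) (@dirac _ _ (vzero R d) R) z))%:E < +oo)%E.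
Hypothesis mu0P : inP1 mu0.
Hypothesis mX0 : forall N i, (i < N)%N -> measurable_fun [set: Omega] (X0 N i).
Hypothesis X0law : forall N i, (i < N)%N -> forall B, measurable B ->
  P (X0 N i @^-1` B) = mu0 B.
Hypothesis meps : forall n i, measurable_fun [set: Omega] (eps n i).
Hypothesis indep : noise_iid_indep P theta X0 eps.
Hypothesis mu_flow : nonlinear_flow A delta f theta mu0 mu.
Hypothesis init_cvg :
  (fun N => \int[P]_w W1 (empirical N (fun i => X0 N i w)) mu0)%E @ \oo --> 0%E.

Let s := fine (maxe 0%E (\int[theta]_z Dlip f z)%E).
Let s0 : 0 <= s. Proof. exact: (Dlip_const_ge0 theta f). Qed.
Let X := particles A delta f X0 eps.
Let Y := nlparticles A delta f X0 eps mu.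
Let muP n : inP1 (mu n). Proof. exact: (flow_inP1 delta0 mf mu_flow). Qed.

Let mY N n i : (i < N)%N -> measurable_fun [set: Omega] (Y N n i).
Proof. by move=> iN; exact: measurable_nlparticles_Omega. Qed.

Let mX N n i : (i < N)%N -> measurable_fun [set: Omega] (X N n i).
Proof.
move=> iN; apply: measurable_particles => //; first exact: leq_ltn_trans iN.
by move=> j jN; exact: mX0.
Qed.

(** [phi] and [L] vary in the induction because each step replaces [phi] by its one-step mean; half
    of [e] pays for the fluctuation around it. *)
Lemma observable_cvg n (phi : d.-tuple R -> R) L e : 0 <= L -> lipw L phi ->
  (forall x, 0 <= phi x <= 1) -> 0 < e ->
  exists N0, forall N, (N0 <= N)%N ->
  (\int[P]_w `|avg N (fun i => phi (Y N n i w)) - \int[mu n]_x phi x|%:E <= e%:E)%E.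
Proof.
elim: n phi L e => [|n ih] phi L e L0 lphi phi01 e0.
  (* [L + 1] is positive even when [L = 0], and [phi / (L + 1)] is admissible in the dual form of
     [W1]. *)
  have L1 : 0 < L + 1 by rewrite ltr_wpDl.
  have mphi := measurable_lipw lphi.
  have lphi1 : lip1 (fun x => (L + 1)^-1 * phi x).
    move=> x y; rewrite -mulrBr normrM ger0_norm ?invr_ge0 ?(ltW L1)//.
    rewrite ler_pdivrMl// (le_trans (lphi x y))// ler_wpM2r ?enorm_ge0//.
    by rewrite lerDl.
  have [|N0 h] := (cvge0P _).1 init_cvg (e / (L + 1)) (divr_gt0 e0 L1).
    by move=> N; apply: integral_ge0 => w _; exact: W1_ge0.
  (* The successor excludes [N = 0], where the empirical measure is the default Dirac mass. *)
  exists N0.+1 => N N0N; have N1 : (0 < N)%N by exact: leq_ltn_trans N0N.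
  have mav : measurable_fun setT
      (fun w => `|avg N (fun i => phi (Y N 0 i w)) - \int[mu 0%N]_x phi x|).
    apply: measurableT_comp => //; apply: measurable_funB => //.
    by apply: measurable_avg => i iN; apply: (measurableT_comp mphi); exact: mY.
  have iphi := lipw_integrable (muP 0) lphi.
  rewrite [e](_ : _ = (L + 1) * (e / (L + 1))); last by rewrite mulrCA divff ?mulr1// gt_eqF.
  rewrite EFinM -lee_pdivrMl// -ge0_integralZl_EFin//; last 2 first.
  - exact/measurable_EFinP.
  - by rewrite invr_ge0 ltW.
  apply: le_trans (h N (ltnW N0N)); apply: le_lower_integral => w.
    by rewrite -EFinM lee_fin mulr_ge0// invr_ge0 ltW.
  apply: ereal_sup_ubound; exists (fun x => (L + 1)^-1 * phi x) => //.
  rewrite integral_empirical//; last exact: measurable_funM.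
  under eq_integral do rewrite EFinM.
  rewrite -mu_flow.1 integralZl// -[X in (_ * X)%E]fineK; last exact: integrable_fin_num iphi.
  rewrite -EFinM -EFinB abse_EFin avgZ -mulrBr normrM -EFinM.
  by rewrite [X in (X * _)%:E = _]ger0_norm// invr_ge0 ltW.
have e4 : 0 < e / 4 by rewrite divr_gt0.
have e2 : 0 < e / 2 by rewrite divr_gt0.
have lg := lipw_flow_mean delta0 mf Df f00 mu0P mu_flow n L0 lphi phi01.
have g01 := flow_mean01 A delta theta mu mf n lphi phi01.
have [|N0 h] := ih _ _ (e / 2) _ lg g01 e2.
  by rewrite mulr_ge0// addr_ge0 ?mxbound_ge0// mulr_ge0// ltW.
have mphi := measurable_lipw lphi; have mg := measurable_lipw lg.
set g := flow_mean _ _ _ _ _ _ _ in h mg.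
(* Ensures [1 / N <= (e / 4)^2], so that the fluctuation bound with [eta = e / 4] is at most
   [e / 2]. *)
pose N1 := (Num.trunc ((e / 4) ^- 2)).+1.
exists (maxn N0 N1) => N; rewrite geq_max => /andP[N0N N1N].
have N00 : (0 < N)%N by exact: leq_ltn_trans N1N.
have NR : 0 < N%:R :> R by rewrite ltr0n.
have Ne : N%:R^-1 / (e / 4) <= e / 4.
  rewrite ler_pdivrMr// -expr2 -[leRHS]invrK lef_pV2 ?posrE ?invr_gt0 ?exprn_gt0//.
  by rewrite (le_trans (ltW (truncnS_gt _)))// ler_nat.
have fl := fluctuation_le delta0 mf Df f00 mu0P mX0 meps indep mu_flow n L0 lphi phi01 N00 e4.
rewrite (Rintegral_flow mf mu_flow n lphi phi01).
have m1 : measurable_fun setT (fun w =>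
    `|avg N (fun i => phi (Y N n.+1 i w)) - avg N (fun i => g (Y N n i w))|).
  apply: measurableT_comp => //; apply: measurable_funB; apply: measurable_avg => i iN.
    by apply: (measurableT_comp mphi); exact: mY.
  by apply: (measurableT_comp mg); exact: mY.
have m2 : measurable_fun setT (fun w =>
    `|avg N (fun i => g (Y N n i w)) - \int[mu n]_x g x|).
  apply: measurableT_comp => //; apply: measurable_funB => //; apply: measurable_avg => i iN.
  by apply: (measurableT_comp mg); exact: mY.
apply: (@le_trans _ _ (\int[P]_w
    (`|avg N (fun i => phi (Y N n.+1 i w)) - avg N (fun i => g (Y N n i w))|%:E +
     `|avg N (fun i => g (Y N n i w)) - \int[mu n]_x g x|%:E))%E).
  apply: le_lower_integral => w; first by rewrite lee_fin.
  by rewrite -EFinD lee_fin; exact: ler_distD.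
rewrite ge0_integralD//; [|exact/measurable_EFinP|exact/measurable_EFinP].
apply: le_trans (leeD fl (h N N0N)) _.
by rewrite -EFinD lee_fin; lra.
Qed.

(* Dominates [W1 (empirical N (Y N n)) (mu n)], by [W1_empirical_le]. *)
Let discrepancy e K n N w : R :=
  4 * e + avg N (fun i => tail e K (Y N n i w)) + \int[mu n]_x tail e K x +
  \sum_(k < K) enorm (ratpt d k : d.-tuple R) *
    `|avg N (fun i => punity e k (Y N n i w)) - \int[mu n]_x punity e k x|.

Let discrepancy_ge0 e K n N w : 0 < e -> 0 <= discrepancy e K n N w.
Proof.
move=> e0; rewrite /discrepancy !addr_ge0//.
- by rewrite mulr_ge0// ltW.
- by apply: avg_ge0 => i _; exact: tail_ge0.
- by apply: Rintegral_ge0 => x _; exact: tail_ge0.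
- by apply: sumr_ge0 => k _; rewrite mulr_ge0// enorm_ge0.
Qed.

Let measurable_discrepancy e K n N : 0 < e ->
  measurable_fun [set: Omega] (discrepancy e K n N).
Proof.
move=> e0; apply: measurable_funD.
  apply: measurable_funD => //; apply: measurable_funD => //.
  apply: measurable_avg => i iN.
  by apply: (measurableT_comp (measurable_tail e0 K)); exact: mY.
apply: measurable_sum => k; apply: measurable_funM => //.
apply: measurableT_comp => //; apply: measurable_funB => //.
apply: measurable_avg => i iN.
by apply: (measurableT_comp (measurable_lipw (lipw_punity e0 k))); exact: mY.
Qed.

(** The 7 is 4 from the approximation, 1 for each of the two tails and 1 for the finite sum. [K] is
    fixed by [mu n] alone, before [N0] is chosen. *)
Lemma discrepancy_cvg n e : 0 < e -> exists K N0, forall N, (N0 <= N)%N ->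
  (\int[P]_w (discrepancy e K n N w)%:E <= (7 * e)%:E)%E.
Proof.
move=> e0; have [K hK] := Rintegral_tail_small e0 (muP n) e0.
pose q := \sum_(k < K) enorm (ratpt d k : d.-tuple R).
have q0 : 0 <= q by apply: sumr_ge0 => k _; exact: enorm_ge0.
have q1 : 0 < q + 1 by rewrite ltr_wpDl.
(* Tolerance per observable: the weights have sum [q], so the weighted total stays below [e]. *)
have eq0 : 0 < e / (q + 1) by rewrite divr_gt0.
have lp k := lipw_punity e0 (d := d) k.
have mp k := measurable_lipw (lp k).
have [N0 h] : exists N0, forall N, (N0 <= N)%N -> forall k : 'I_K,
    (\int[P]_w `|avg N (fun i => punity e k (Y N n i w)) - \int[mu n]_x punity e k x|%:E
      <= (e / (q + 1))%:E)%E.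
  have ei : 0 <= e^-1 + e^-1 by rewrite addr_ge0// invr_ge0 ltW.
  have hk (k : 'I_K) := observable_cvg n ei (lp k)
    (fun x => introT andP (conj (punity_ge0 e k x) (punity_le1 e k x))) eq0.
  exists (\max_(k < K) sval (cid (hk k))) => N hN k.
  apply: (svalP (cid (hk k))); apply: leq_trans hN.
  exact: (leq_bigmax (F := fun k => sval (cid (hk k))) k).
exists K, N0.+1 => N N0N; have N1 : (0 < N)%N by exact: leq_ltn_trans N0N.
have mtY : measurable_fun setT (fun w => avg N (fun i => tail e K (Y N n i w))).
  apply: measurable_avg => i iN.
  by apply: (measurableT_comp (measurable_tail e0 K)); exact: mY.
have mpY k : measurable_fun setT
    (fun w => `|avg N (fun i => punity e k (Y N n i w)) - \int[mu n]_x punity e k x|).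
  apply: measurableT_comp => //; apply: measurable_funB => //.
  apply: measurable_avg => i iN.
  by apply: (measurableT_comp (mp k)); exact: mY.
have tY0 w : 0 <= avg N (fun i => tail e K (Y N n i w)).
  by apply: avg_ge0 => i _; exact: tail_ge0.
have Rt0 : 0 <= \int[mu n]_x tail e K x by apply: Rintegral_ge0 => x _; exact: tail_ge0.
(* Each particle has law [mu n], so the unbounded tail is handled by its mean alone, which is the
   same for every [N]. *)
have Et : (\int[P]_w (avg N (fun i => tail e K (Y N n i w)))%:E = (\int[mu n]_x tail e K x)%:E)%E.
  rewrite (@ge0_integral_avg _ _ _ P N (fun i w => tail e K (Y N n i w))); last 2 first.
  - by move=> i iN; apply: (measurableT_comp (measurable_tail e0 K)); exact: mY.
  - by move=> i w; exact: tail_ge0.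
  rewrite (eq_bigr (fun=> (\int[mu n]_x tail e K x)%:E)).
    by rewrite sumEFin -EFinM; congr EFin; exact: (avg_cst _ N1).
  move=> i _.
  rewrite (nlparticles_law mf mX0 X0law meps indep mu_flow n (i := i) (N := N)
    (h := fun x => (tail e K x)%:E)) //.
  - by rewrite fineK//; apply: integrable_fin_num => //; exact: integrable_tail.
  - by apply/measurable_EFinP; exact: measurable_tail.
  - by move=> x; rewrite lee_fin tail_ge0.
have c0 : 0 <= 4 * e + \int[mu n]_x tail e K x by rewrite addr_ge0// mulr_ge0// ltW.
under eq_integral => w _.
  rewrite (_ : discrepancy e K n N w = (4 * e + \int[mu n]_x tail e K x) +
    avg N (fun i => tail e K (Y N n i w)) +
    \sum_(k < K) enorm (ratpt d k : d.-tuple R) *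
    `|avg N (fun i => punity e k (Y N n i w)) - \int[mu n]_x punity e k x|); last first.
    by rewrite /discrepancy; ring.
  rewrite EFinD EFinD -sumEFin.
  over.
rewrite ge0_integralD//=; last 4 first.
- by move=> w _; rewrite -EFinD lee_fin addr_ge0.
- by apply: emeasurable_funD => //; exact/measurable_EFinP.
- by move=> w _; apply: sume_ge0 => k _; rewrite lee_fin mulr_ge0// enorm_ge0.
- apply: emeasurable_sum => k; apply/measurable_EFinP; exact: measurable_funM.
rewrite ge0_integralD//=; last 2 first.
- by move=> w _; rewrite lee_fin.
- exact/measurable_EFinP.
rewrite probability_integral_cst Et ge0_integral_sum//=; last 2 first.
- by move=> k; apply/measurable_EFinP; exact: measurable_funM.
- by move=> k w _; rewrite lee_fin mulr_ge0// enorm_ge0.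
have Es : (\sum_(k < K) \int[P]_w (enorm (ratpt d k : d.-tuple R) *
    `|avg N (fun i => punity e k (Y N n i w)) - \int[mu n]_x punity e k x|)%:E <= e%:E)%E.
  apply: (@le_trans _ _ (\sum_(k < K) (enorm (ratpt d k : d.-tuple R) * (e / (q + 1)))%:E)%E).
    apply: lee_sum => k _; under eq_integral do rewrite EFinM.
    rewrite ge0_integralZl_EFin ?enorm_ge0//; last exact/measurable_EFinP.
    by rewrite EFinM lee_wpmul2l ?lee_fin ?enorm_ge0// h// ltnW.
  rewrite sumEFin lee_fin -mulr_suml -/q mulrCA ger_pMr//.
  by rewrite ler_pdivrMr// mul1r lerDl.
apply: le_trans (leeD (lexx _) Es) _.
by rewrite -!EFinD lee_fin; lra.
Qed.

Let dist N n w : R := avg N (fun i => enorm (vsub (X N n i w) (Y N n i w))).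

Let dist_ge0 N n w : 0 <= dist N n w.
Proof. by apply: avg_ge0 => i _; exact: enorm_ge0. Qed.

Let menorm N n i : (i < N)%N ->
  measurable_fun [set: Omega] (fun w => enorm (vsub (X N n i w) (Y N n i w))).
Proof.
move=> iN; apply: (measurableT_comp (@measurable_enorm R d)).
by apply: measurable_vsub; [exact: mX|exact: mY].
Qed.

Let mdist N n : measurable_fun [set: Omega] (dist N n).
Proof. by apply: measurable_avg => i iN; exact: menorm. Qed.

Let W1_particles_le e K n N w : (0 < N)%N -> 0 < e ->
  (W1 (empirical N (fun i => X N n i w)) (mu n) <= (dist N n w + discrepancy e K n N w)%:E)%E.
Proof. by move=> N0 e0; exact: (W1_empirical_le e0 (muP n)). Qed.

(** With the state at time [n] frozen, the new noise is integrated out and the averaged Lipschitz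
    bound applies, [r] being the measurable majorant of the Wasserstein distance. *)
Lemma integral_kernel_dist_le e K n N i : (i < N)%N -> 0 < e ->
  (\int[P]_w (enorm (vsub
     (f (X N n i w) (empirical N (fun j => X N n j w)) (eps n i w))
     (f (Y N n i w) (mu n) (eps n i w))))%:E <=
   \int[P]_w (s * (enorm (vsub (X N n i w) (Y N n i w)) +
      (dist N n w + discrepancy e K n N w)))%:E)%E.
Proof.
move=> iN e0; have N0 : (0 < N)%N by exact: leq_ltn_trans iN.
pose T : measurableType _ := past X0 eps (noise_before n N) (init_indices N).
pose H (p : ((d.-tuple R * giry (d.-tuple R) R) * d.-tuple R) * m.-tuple R) :=
  (enorm (vsub (f p.1.1.1 p.1.1.2 p.2) (f p.1.2 (mu n) p.2)))%:E.
rewrite (@integral_fresh_noise _ _ _ _ _ P theta X0 eps mX0 meps indep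
    (noise_before n N) (init_indices N) (n, i) _ _
    (fun w => ((X N n i w, empirical N (fun j => X N n j w) : giry _ R), Y N n i w)) H).
- apply: le_lower_integral => w.
    by apply: integral_ge0 => z _; rewrite lee_fin enorm_ge0.
  apply: (kernel_dist_le mf Df); [exact: inP1_empirical|exact: muP|].
  exact: W1_particles_le.
- exact: uniq_noise_before.
- exact: all_init_indices.
- by rewrite mem_noise_before ltnn.
- have mXT j : (j < N)%N -> measurable_fun [set: T] (X N n j : T -> _).
    move=> jN; apply: (@measurable_particles _ _ _ _ T) => //.
      move=> k kN.
      exact: (@measurable_init_past _ _ _ _ _ X0 eps _ _ (N, k) (mem_init_indices kN)).
    move=> k l kn lN; apply: (@measurable_noise_past _ _ _ _ _ X0 eps _ _ (k, l)).
    by rewrite mem_noise_before kn.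
  apply: measurable_fun_pair; last exact: measurable_nlparticles_past.
  apply: measurable_fun_pair; first exact: mXT.
  exact: (@measurable_empirical _ _ _ T).
- apply/measurable_EFinP; apply: (measurableT_comp (@measurable_enorm R d)).
  apply: measurable_vsub.
    apply: (measurableT_comp mf (g := fun p :
      ((d.-tuple R * giry (d.-tuple R) R) * d.-tuple R) * m.-tuple R => (p.1.1, p.2))).
    by apply: measurable_fun_pair => //; exact: measurableT_comp.
  apply: (measurableT_comp mf (g := fun p :
      ((d.-tuple R * giry (d.-tuple R) R) * d.-tuple R) * m.-tuple R =>
      ((p.1.2, mu n : giry _ R), p.2))).
  apply: measurable_fun_pair => //; apply: measurable_fun_pair => //.
  exact: measurableT_comp.
- by move=> p; rewrite lee_fin enorm_ge0.
Qed.

Lemma coupling_cvg n e : 0 < e -> exists N0, forall N, (N0 <= N)%N ->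
  (\int[P]_w (dist N n w)%:E <= e%:E)%E.
Proof.
elim: n e => [|n ih] e e0.
  exists 0%N => N _; rewrite integral0_eq ?lee_fin ?ltW// => w _.
  by rewrite /dist /avg big1 ?mulr0// => i _; exact: enorm_vsubxx.
have CA0 := mxbound_ge0 A.
have ds0 : 0 <= delta * s by rewrite mulr_ge0// ltW.
(* [dist] enters the kernel bound twice, through the particle's own displacement and through the
   measure argument; the [+ 1] makes [c] positive. *)
pose c := mxbound A + 2 * (delta * s) + 1.
have c0 : 0 < c by rewrite /c; lra.
pose e1 := e / (2 * c).
have e10 : 0 < e1 by rewrite divr_gt0// mulr_gt0.
(* [14] is [2 * 7]: the discrepancy costs [7 * e2], which times [delta * s + 1] is [e / 2]. *)
pose e2 := e / (14 * (delta * s + 1)).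
have ds1 : 0 < delta * s + 1 by lra.
have e20 : 0 < e2 by rewrite divr_gt0// mulr_gt0.
have [N1 h1] := ih e1 e10.
have [K [N2 h2]] := discrepancy_cvg n e20.
exists (maxn N1 N2).+1 => N NN.
have N0 : (0 < N)%N by exact: leq_ltn_trans NN.
have {}h1 : (\int[P]_w (dist N n w)%:E <= e1%:E)%E.
  by apply: h1; rewrite (leq_trans _ (ltnW NN))// leq_maxl.
have {}h2 : (\int[P]_w (discrepancy e2 K n N w)%:E <= (7 * e2)%:E)%E.
  by apply: h2; rewrite (leq_trans _ (ltnW NN))// leq_maxr.
have U0 w : 0 <= discrepancy e2 K n N w by exact: discrepancy_ge0.
have mU : measurable_fun [set: Omega] (discrepancy e2 K n N) by exact: measurable_discrepancy.
pose F i w := enorm (vsub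
     (f (X N n i w) (empirical N (fun j => X N n j w)) (eps n i w))
     (f (Y N n i w) (mu n) (eps n i w))).
pose G i w := s * (enorm (vsub (X N n i w) (Y N n i w)) +
      (dist N n w + discrepancy e2 K n N w)).
have mF i : (i < N)%N -> measurable_fun [set: Omega] (F i).
  move=> iN; apply: (measurableT_comp (@measurable_enorm R d)); apply: measurable_vsub.
    apply: (measurableT_comp mf (g := fun w => ((X N n i w,
      empirical N (fun j => X N n j w) : giry _ R), eps n i w))).
    apply: measurable_fun_pair => //; apply: measurable_fun_pair; first exact: mX.
    by apply: measurable_empirical => // j jN; exact: mX.
  apply: (measurableT_comp mf (g := fun w => ((Y N n i w, mu n : giry _ R), eps n i w))).
  by apply: measurable_fun_pair => //; apply: measurable_fun_pair => //; exact: mY.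
have mG i : (i < N)%N -> measurable_fun [set: Omega] (G i).
  move=> iN; apply: measurable_funM => //; apply: measurable_funD; first exact: menorm.
  exact: measurable_funD.
have FG : (\int[P]_w (avg N (F ^~ w))%:E <= \int[P]_w (avg N (G ^~ w))%:E)%E.
  apply: ge0_le_integral_avg => //.
  - by move=> i w; exact: enorm_ge0.
  - by move=> i w; rewrite mulr_ge0// addr_ge0 ?enorm_ge0// addr_ge0.
  - by move=> i iN; exact: integral_kernel_dist_le.
have GE w : avg N (G ^~ w) = s * (2 * dist N n w + discrepancy e2 K n N w).
  by rewrite /G avgZ avgD avg_cst// -/(dist N n w); congr (_ * _); ring.
have mavgF : measurable_fun [set: Omega] (fun w => avg N (F ^~ w)) by exact: measurable_avg.
have avgF0 w : 0 <= avg N (F ^~ w) by apply: avg_ge0 => i _; exact: enorm_ge0.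
apply: (@le_trans _ _ (\int[P]_w
    ((mxbound A * dist N n w)%:E + (delta * avg N (F ^~ w))%:E))%E).
  apply: le_lower_integral => w; first by rewrite lee_fin.
  rewrite -EFinD lee_fin -!avgZ -avgD; apply: ler_avg => i iN.
  by apply: enorm_step_vsub; exact: ltW.
rewrite ge0_integralD//; last 4 first.
- by move=> w _; rewrite lee_fin mulr_ge0.
- by apply/measurable_EFinP; exact: measurable_funM.
- by move=> w _; rewrite lee_fin mulr_ge0// ltW.
- by apply/measurable_EFinP; exact: measurable_funM.
under eq_integral do rewrite EFinM.
under [X in (_ + X)%E]eq_integral do rewrite EFinM.
rewrite ge0_integralZl_EFin//; last 2 first.
- by move=> w _; rewrite lee_fin.
- exact/measurable_EFinP.
rewrite ge0_integralZl_EFin//; last 3 first.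
- by move=> w _; rewrite lee_fin.
- exact/measurable_EFinP.
- exact: ltW.
have EG : (\int[P]_w (avg N (G ^~ w))%:E <= (s * (2 * e1 + 7 * e2))%:E)%E.
  under eq_integral do rewrite GE EFinM EFinD EFinM.
  rewrite ge0_integralZl_EFin//; last 2 first.
  - by move=> w _; rewrite -EFinM -EFinD lee_fin addr_ge0// mulr_ge0.
  - apply: emeasurable_funD; last exact/measurable_EFinP.
    by apply: measurable_funeM; exact/measurable_EFinP.
  rewrite EFinM lee_wpmul2l ?lee_fin// ge0_integralD//; last 4 first.
  - by move=> w _; rewrite -EFinM lee_fin mulr_ge0.
  - by apply: measurable_funeM; exact/measurable_EFinP.
  - by move=> w _; rewrite lee_fin.
  - exact/measurable_EFinP.
  rewrite ge0_integralZl_EFin//; last 2 first.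
  - by move=> w _; rewrite lee_fin.
  - exact/measurable_EFinP.
  by rewrite [leRHS]EFinD leeD// [leRHS]EFinM lee_wpmul2l.
apply: (@le_trans _ _ ((mxbound A)%:E * e1%:E + delta%:E * (s * (2 * e1 + 7 * e2))%:E)%E).
  by rewrite leeD// lee_wpmul2l ?lee_fin ?(ltW delta0)// (le_trans FG).
rewrite -!EFinM -EFinD lee_fin.
have e1c : e1 * c = e / 2 by rewrite /e1; field; rewrite gt_eqF.
have e2c : 7 * e2 * (delta * s + 1) = e / 2 by rewrite /e2; field; rewrite gt_eqF.
rewrite [leLHS](_ : _ = e1 * c - e1 + (7 * e2 * (delta * s + 1) - 7 * e2)).
  have e27 : 0 <= 7 * e2 by apply: mulr_ge0 => //; exact: ltW.
  by rewrite e1c e2c [leRHS]splitr; apply: lerD; rewrite gerBl//; exact: ltW.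
by rewrite /c; ring.
Qed.

Lemma particles_W1_cvg n :
  (fun N => \int[P]_w W1 (empirical N (fun i => X N n i w)) (mu n))%E @ \oo --> 0%E.
Proof.
apply/cvge0P => [N|e e0]; first by apply: integral_ge0 => w _; exact: W1_ge0.
(* One eighth for the coupling error, seven for the discrepancy. *)
have e8 : 0 < e / 8 by rewrite divr_gt0.
have [N1 h1] := coupling_cvg n e8.
have [K [N2 h2]] := discrepancy_cvg n e8.
exists (maxn N1 N2).+1 => N NN.
have N0 : (0 < N)%N by exact: leq_ltn_trans NN.
have {}h1 : (\int[P]_w (dist N n w)%:E <= (e / 8)%:E)%E.
  by apply: h1; rewrite (leq_trans _ (ltnW NN))// leq_maxl.
have {}h2 : (\int[P]_w (discrepancy (e / 8) K n N w)%:E <= (7 * (e / 8))%:E)%E.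
  by apply: h2; rewrite (leq_trans _ (ltnW NN))// leq_maxr.
apply: (@le_trans _ _ (\int[P]_w ((dist N n w)%:E + (discrepancy (e / 8) K n N w)%:E))%E).
  apply: le_lower_integral => w; first exact: W1_ge0.
  exact: W1_particles_le.
rewrite ge0_integralD//; last 4 first.
- by move=> w _; rewrite lee_fin.
- exact/measurable_EFinP.
- by move=> w _; rewrite lee_fin; exact: discrepancy_ge0.
- by apply/measurable_EFinP; exact: measurable_discrepancy.
by apply: le_trans (leeD h1 h2) _; rewrite -EFinD lee_fin; lra.
Qed.

End convergence.

Local Open Scope ereal_scope.

Theorem theorem3p1 (R : realType) (d m : nat) (A : 'M[R]_d) (delta : R)
  (theta : probability (m.-tuple R) R)
  (f : d.-tuple R -> giry (d.-tuple R) R -> m.-tuple R -> d.-tuple R)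
  (dO : measure_display) (Omega : measurableType dO) (P : probability Omega R)
  (mu0 : probability (d.-tuple R) R)
  (X0 : nat -> nat -> Omega -> d.-tuple R) (eps : nat -> nat -> Omega -> m.-tuple R)
  (mu : nat -> probability (d.-tuple R) R) :
  (0 < delta)%R ->
  (* f is measurable *)
  measurable_fun [set: (d.-tuple R * giry (d.-tuple R) R) * m.-tuple R]
    (fun p => f p.1.1 p.1.2 p.2) ->
  (* (A1) *)
  (\int[theta]_z Dlip f z < +oo)%E ->
  (* (A2) *)
  (\int[theta]_z (enorm (f (@vzero R d) (@dirac _ _ (@vzero R d) R) z))%:E < +oo)%E ->
  (* mu0 in P_1(R^d) *)
  inP1 mu0 ->
  (* initial conditions: random variables, each with law mu0, exchangeable for each N *)
  (forall N i, (i < N)%N -> measurable_fun [set: Omega] (X0 N i)) ->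
  (forall N i, (i < N)%N -> forall B, measurable B -> P (X0 N i @^-1` B) = mu0 B) ->
  exchangeable_init P X0 ->
  (* noises: random variables, i.i.d. with law theta, independent of initial conditions *)
  (forall n i, measurable_fun [set: Omega] (eps n i)) ->
  noise_iid_indep P theta X0 eps ->
  (* mu_n = Psi^n(mu0) *)
  nonlinear_flow A delta f theta mu0 mu ->
  (* E W1(mu_0^N, mu_0) -> 0 *)
  ((fun N => \int[P]_w W1 (empirical N (fun i => X0 N i w)) mu0) @ \oo --> 0%E) ->
  forall n : nat,
    (fun N => \int[P]_w W1 (empirical N (fun i => particles A delta f X0 eps N n i w)) (mu n))
      @ \oo --> 0%E.
Proof.
move=> delta0 mf Df f00 mu0P mX0 X0law _ meps indep mu_flow init_cvg n.
exact: (particles_W1_cvg delta0 mf Df f00 mu0P mX0 X0law meps indep mu_flow init_cvg).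
Qed.
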